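(* Let $a\in\mathbb{R}$. The modified CLM equation $$\omega_t+u\,\omega_x+a\,u_x\,\omega=0,\qquad \omega=\Lambda u,$$ describes the geodesic flow of a right-invariant symmetric linear connection on the Fréchet Lie group $\mathrm{Diff}_1^\infty(\mathbb{S})$; that is, there is a right-invariant symmetric linear connection on $\mathrm{Diff}_1^\infty(\mathbb{S})$ such that a smooth curve $\varphi(t)$ in $\mathrm{Diff}_1^\infty(\mathbb{S})$ is a geodesic if and only if its Eulerian velocity $u=\varphi_t\circ\varphi^{-1}$ satisfies this equation. If $a=2$, the geodesic flow is metric and corresponds to the right-invariant homogeneous $\dot H^{1/2}(\mathbb{S})$ metric, i.e. the connection is compatible with that metric.
   Context: $\mathbb{S}=\mathbb{R}/\mathbb{Z}$. $\mathrm{Diff}_1^\infty(\mathbb{S})$ is the Fréchet Lie group of smooth orientation-preserving diffeomorphisms of $\mathbb{S}$ fixing the base point (denoted $1$; it corresponds to $x=0$). It is described by the global chart $\{\mathrm{id}+u:\ u\in C^\infty(\mathbb{S}),\ u_x>-1,\ u(0)=0\}$, and its Lie algebra is $C^\infty_0(\mathbb{S}):=\{u\in C^\infty(\mathbb{S}): u(0)=0\}$ with bracket $[u,v]=u_xv-uv_x$. $D=d/dx$; $H$ is the Hilbert transform, the Fourier multiplier with symbol $-i\,\mathrm{sgn}(n)$ (with $\mathrm{sgn}(0)=0$) with respect to $e^{2\pi i n x}$, $n\in\mathbb{Z}$; $\Lambda:=H\circ D$, an isomorphism from $C^\infty_0(\mathbb{S})$ onto the space of smooth functions of mean zero. A right-invariant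 symmetric linear connection on $\mathrm{Diff}_1^\infty(\mathbb{S})$ is given by a continuous symmetric bilinear operator $B$ on $C_0^\infty(\mathbb{S})$: on right-invariant vector fields $\nabla_{\xi_u}\xi_v=\tfrac12[\xi_u,\xi_v]+B(\xi_u,\xi_v)$ (bracket of vector fields, $\xi_u(\varphi)=u\circ\varphi$). Equivalently, for a curve $\varphi(t)$ with $u=\varphi_t\circ\varphi^{-1}$ and a vector field $\xi(t)=w(t)\circ\varphi(t)$ along it, with $w(t)\in C^\infty_0(\mathbb{S})$, the covariant derivative is $$\frac{D\xi}{Dt}=\Big(w_t+\tfrac12(uw_x-u_xw)+B(u,w)\Big)\circ\varphi .$$ The curve $\varphi$ is a geodesic if $\frac{D\varphi_t}{Dt}=0$, i.e. $u_t=-B(u,u)$. The connection is compatible with (preserves) a metric if $\frac{d}{dt}\langle\xi,\eta\rangle_\varphi=\langle\frac{D\xi}{Dt},\eta\rangle_\varphi+\langle\xi,\frac{D\eta}{Dt}\rangle_\varphi$ for all vector fields $\xi,\eta$ along all curves $\varphi$. The right-invariant $\dot H^{1/2}$ metric is $\langle\eta,\xi\rangle_\varphi=\int_{\mathbb{S}}(\eta\circ\varphi^{-1})\,\Lambda(\xi\circ\varphi^{-1})\,dx$ for $\eta,\xi\in T_\varphi\mathrm{Diff}_1^\infty(\mathbb{S})$. *)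

(* Defs.v *)
From Stdlib Require Import Reals ZArith ClassicalEpsilon.
From Coquelicot Require Import Coquelicot.

Open Scope R_scope.

(** Functions on the circle R/Z are 1-periodic functions on R; a diffeomorphism
    of the circle fixing the base point is identified with its lift fixing 0. *)

Definition Cinf (f : R -> R) : Prop :=
  (forall x, f (x + 1) = f x) /\ (forall n x, ex_derive_n f n x).

Definition C0inf (f : R -> R) : Prop := Cinf f /\ f 0 = 0.

(** Neighbourhoods of [f] in the Fréchet space of smooth functions on the
    circle, whose topology is generated by the C^k norms. *)
Definition Cinf_locally (f : R -> R) (P : (R -> R) -> Prop) : Prop :=
  exists (k : nat) (eps : posreal), forall g : R -> R, Cinf g ->
    (forall j x, (j <= k)%nat -> Rabs (Derive_n g j x - Derive_n f j x) < eps) ->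
    P g.

(** [c : R -> R -> R] is a curve [t |-> c t] of functions of [x]. *)

Definition in_itv (t0 t1 : Rbar) (t : R) : Prop := Rbar_lt t0 t /\ Rbar_lt t t1.

(** [d] is the derivative of [c] at [t] as a curve in the Fréchet space. *)
Definition is_curve_derive (c : R -> R -> R) (t : R) (d : R -> R) : Prop :=
  filterlim (fun h x => (c (t + h) x - c t x) / h) (locally' 0) (Cinf_locally d).

Definition dt_n (c : R -> R -> R) (n : nat) (t x : R) : R :=
  Derive_n (fun s => c s x) n t.

Definition dt (c : R -> R -> R) (t x : R) : R := Derive (fun s => c s x) t.

(** Smooth curves in the Fréchet space [C0inf]: all the iterated derivatives
    exist in the Fréchet topology. Evaluation at [x] being continuous, the n-th
    one can only be the pointwise derivative [dt_n c n]. *)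
Definition smooth_curve (t0 t1 : Rbar) (c : R -> R -> R) : Prop :=
  forall t, in_itv t0 t1 t -> forall n,
    C0inf (dt_n c n t) /\ is_curve_derive (dt_n c n) t (dt_n c (S n) t).

Definition chart (f : R -> R) (x : R) : R := f x - x.

Definition Diff1 (f : R -> R) : Prop :=
  C0inf (chart f) /\ (forall x, Derive (chart f) x > -1).

Definition smooth_Diff1_curve (t0 t1 : Rbar) (phi : R -> R -> R) : Prop :=
  (forall t, in_itv t0 t1 t -> Diff1 (phi t)) /\
  smooth_curve t0 t1 (fun t => chart (phi t)).

Definition inv_fun (f : R -> R) (y : R) : R :=
  epsilon (inhabits 0) (fun x => f x = y).

(** [w = xi o phi^-1] for a vector field [xi] along the curve [phi]. *)
Definition eulerian (phi xi : R -> R -> R) (t x : R) : R :=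
  xi t (inv_fun (phi t) x).

Definition velocity (phi : R -> R -> R) : R -> R -> R := eulerian phi (dt phi).

Definition Cexp_i (theta : R) : C := (cos theta, sin theta).

Definition fourier_coef (f : R -> R) (n : Z) : C :=
  RInt (V := C_R_CompleteNormedModule)
    (fun x => (RtoC (f x) * Cexp_i (- (2 * PI * IZR n * x)))%C) 0 1.

Definition CLim_seq (s : nat -> C) : C :=
  (real (Lim_seq (fun N => Re (s N))), real (Lim_seq (fun N => Im (s N)))).

(** The sum over [n : Z] is the limit of the symmetric partial sums over
    [-N <= n <= N]. *)
Definition fourier_multiplier (m : Z -> C) (f : R -> R) (x : R) : C :=
  CLim_seq (fun N => sum_n (fun k =>
    let n := (Z.of_nat k - Z.of_nat N)%Z in
    (m n * fourier_coef f n * Cexp_i (2 * PI * IZR n * x))%C) (2 * N)).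

(** The multiplier is real-valued on real functions, as its symbol [m]
    satisfies [m (- n) = Cconj (m n)]. *)
Definition Hilbert (f : R -> R) (x : R) : R :=
  Re (fourier_multiplier (fun n => (- (Ci * RtoC (IZR (Z.sgn n))))%C) f x).

Definition Lambda (u : R -> R) : R -> R := Hilbert (Derive u).

(** A right-invariant symmetric linear connection is given by a continuous
    symmetric bilinear operator on [C0inf]; the values of [conn_op] outside
    [C0inf] are irrelevant. *)
Record ri_sym_connection := {
  conn_op :> (R -> R) -> (R -> R) -> R -> R;
  conn_C0inf : forall u v, C0inf u -> C0inf v -> C0inf (conn_op u v);
  conn_sym : forall u v, C0inf u -> C0inf v ->
    forall x, conn_op u v x = conn_op v u x;
  conn_plus : forall u v w, C0inf u -> C0inf v -> C0inf w ->
    forall x, conn_op (fun y => u y + v y) w x = conn_op u w x + conn_op v w x;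
  conn_scal : forall (l : R) u v, C0inf u -> C0inf v ->
    forall x, conn_op (fun y => l * u y) v x = l * conn_op u v x;
  conn_continuous : forall u v, C0inf u -> C0inf v ->
    filterlim (fun p => conn_op (fst p) (snd p))
      (filter_prod (within C0inf (Cinf_locally u))
                   (within C0inf (Cinf_locally v)))
      (Cinf_locally (conn_op u v))
}.

(** Covariant derivative along [phi] of the vector field [xi = w o phi]. *)
Definition cov_derive (B : ri_sym_connection) (phi xi : R -> R -> R)
    (t y : R) : R :=
  let u := velocity phi in
  let w := eulerian phi xi in
  let x := phi t y in
  dt w t x + / 2 * (u t x * Derive (w t) x - Derive (u t) x * w t x)
  + B (u t) (w t) x.

Definition geodesic (B : ri_sym_connection) (t0 t1 : Rbar)
    (phi : R -> R -> R) : Prop :=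
  forall t, in_itv t0 t1 t -> forall y, cov_derive B phi (dt phi) t y = 0.

Definition mCLM (a : R) (t0 t1 : Rbar) (u : R -> R -> R) : Prop :=
  let omega := fun t => Lambda (u t) in
  forall t, in_itv t0 t1 t -> forall x,
    ex_derive (fun s => omega s x) t /\ ex_derive (omega t) x /\
    dt omega t x + u t x * Derive (omega t) x
    + a * Derive (u t) x * omega t x = 0.

Definition Hhalf_metric (phi eta xi : R -> R) : R :=
  RInt (fun x => eta (inv_fun phi x) * Lambda (fun z => xi (inv_fun phi z)) x)
    0 1.

Definition compatible_with (g : (R -> R) -> (R -> R) -> (R -> R) -> R)
    (B : ri_sym_connection) : Prop :=
  forall (t0 t1 : Rbar) (phi xi eta : R -> R -> R),
    smooth_Diff1_curve t0 t1 phi ->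
    smooth_curve t0 t1 xi -> smooth_curve t0 t1 eta ->
    forall t, in_itv t0 t1 t ->
      is_derive (fun s => g (phi s) (xi s) (eta s)) t
        (g (phi t) (cov_derive B phi xi t) (eta t)
         + g (phi t) (xi t) (cov_derive B phi eta t)).

(* Main.v *)
Require Import Defs.
From Stdlib Require Import Reals ZArith Lra Lia Psatz.
From Stdlib Require Import FunctionalExtensionality ClassicalEpsilon.
From Coquelicot Require Import Coquelicot.

Open Scope R_scope.

(** Write [H] for the Hilbert transform, [D] for the space derivative, and
    [Lambda = H D].  The equation reads [Lambda u_t = - m(u,u)], where
    [m(u,v) = 1/2 (u Lambda v' + v Lambda u' + a (u' Lambda v + v' Lambda u))]
    is the polarization of [u w_x + a u_x w], [w = Lambda u].  Integrating by
    parts, the mean of [m(u,v)] is [(a-1)/2] times that of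
    [u' H v' + v' H u'], which vanishes because [H] is skew-symmetric.  Since
    [Lambda] is an isomorphism onto the functions of mean zero, the equation is
    [u_t = - B(u,u)] with [B = Lambda^-1 m] ([christoffel]), which is the
    geodesic equation of the connection defined by [B]
    ([geodesic_equation], [geodesic_iff_mCLM]).

    For [a = 2], let [w] and [z] be two fields in Eulerian form.  Their product
    is [int w Lambda z], and [Lambda] is symmetric, so the time derivatives of
    [w] and [z] contribute what the covariant derivative asks for, and the
    connection terms contribute the integral of
    [(1/2 w u Lambda z + 1/2 z u Lambda w + w z Lambda u)_x], that is, zero
    ([metric_defect], [Hhalf_compatible]).

    Two bodies of analysis support this computation.

    The first is the calculus of [H], given as the symmetric limit of a Fourier
    series.  On smooth functions the terms decay like [n^-2] with a constant
    controlled by the second derivative ([hterm_bound]), whence [H] commutes with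
    [D], preserves smoothness, is bounded at the cost of two derivatives, and may
    be integrated termwise, which gives skewness ([Hilbert_skew]).  The inversion formula
    [H H f = - f] for [f] of mean zero ([Hilbert_Hilbert]) is reduced to the
    uniqueness of Fourier coefficients ([fourier_null_eq_0]), proved by testing
    against powers of the positive kernel [cos^2 (pi (x - x0))].

    The second is that the Eulerian velocity, and more generally
    [xi o phi^-1] for smooth curves [phi] and [xi], is again a curve in the
    Frechet space that can be differentiated in time.  A smooth curve is a
    function of time and space with jointly continuous partial derivatives of
    all orders ([smooth_curve_joint_smooth]); this class is stable under
    composition and, by the implicit function formulas, under inversion of
    diffeomorphisms ([inverse_joint_smooth]); and the mean value theorem, with
    uniform continuity over a period, leads back to Frechet derivatives
    ([joint_smooth_has_curve_derive]).  As [Lambda] and the pairing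
    [int f Lambda g] are continuous, they can then be differentiated along such
    curves ([is_derive_Lambda_curve], [is_derive_pairing]). *)

(** * Smooth functions of one variable *)

(** Equations inherited from the general theory of integrals live in a module
    structure over [R], where [ring] does not see real numbers. *)
Ltac eq_R := match goal with |- @eq _ ?a ?b => change (@eq R a b) end.

(** Regularity of finite order, built so that closure properties follow by
    induction on the order, the product rule being one step. *)
Fixpoint Ck (n : nat) (f : R -> R) : Prop :=
  match n with
  | O => True
  | S m => (forall x, ex_derive f x) /\ Ck m (Derive f)
  end.

Definition smooth (f : R -> R) : Prop := forall n x, ex_derive_n f n x.

Lemma Derive_n_Derive f n : Derive_n f (S n) = Derive_n (Derive f) n.
Proof.
  apply functional_extensionality; intro x.
  change (Derive f) with (Derive_n f 1).
  rewrite Derive_n_comp. now replace (n + 1)%nat with (S n) by lia.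
Qed.

Lemma smooth_ex_derive f : smooth f -> forall x, ex_derive f x.
Proof. intros H x; exact (H 1%nat x). Qed.

Lemma smooth_Derive f : smooth f -> smooth (Derive f).
Proof.
  intros H [|n] x; [exact I|].
  generalize (H (S (S n)) x).
  change (ex_derive (Derive_n f (S n)) x -> ex_derive (Derive_n (Derive f) n) x).
  now rewrite Derive_n_Derive.
Qed.

Lemma smooth_intro f : (forall x, ex_derive f x) -> smooth (Derive f) -> smooth f.
Proof.
  intros H1 H2 [|[|n]] x; [exact I|exact (H1 x)|].
  change (ex_derive (Derive_n f (S n)) x).
  rewrite Derive_n_Derive. exact (H2 (S n) x).
Qed.

Lemma smooth_Ck f : smooth f <-> forall n, Ck n f.
Proof.
  split.
  - intros H n; revert f H; induction n as [|n IH]; intros f H; [exact I|].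
    split; [now apply smooth_ex_derive|]. now apply IH, smooth_Derive.
  - intros H n; revert f H; induction n as [|n IH]; intros f H x; [exact I|].
    destruct n as [|n]; [exact (proj1 (H 1%nat) x)|].
    change (ex_derive (Derive_n f (S n)) x).
    rewrite Derive_n_Derive.
    apply (IH (Derive f)). intro m. exact (proj2 (H (S m))).
Qed.

Lemma Ck_S n f : Ck (S n) f -> Ck n f.
Proof.
  revert f; induction n as [|n IH]; intros f H; [exact I|].
  destruct H as [H1 H2]. split; [exact H1|]. now apply IH.
Qed.

Lemma is_derive_Derive f f' : (forall x, is_derive f x (f' x)) -> Derive f = f'.
Proof.
  intros H; apply functional_extensionality; intro x. now apply is_derive_unique.
Qed.

Lemma Ck_is_derive n f f' : (forall x, is_derive f x (f' x)) -> Ck n f' -> Ck (S n) f.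
Proof.
  intros H H'. split; [intro x; eexists; apply H|]. now rewrite (is_derive_Derive _ _ H).
Qed.

Lemma smooth_is_derive f f' : (forall x, is_derive f x (f' x)) -> smooth f' -> smooth f.
Proof.
  intros H H'. apply smooth_intro; [intro x; eexists; apply H|].
  now rewrite (is_derive_Derive _ _ H).
Qed.

Lemma Ck_const n c : Ck n (fun _ => c).
Proof.
  revert c; induction n as [|n IH]; intro c; [exact I|].
  apply (Ck_is_derive n _ (fun _ => 0)); [|apply IH].
  intro x; apply @is_derive_const.
Qed.

Lemma Ck_plus n f g : Ck n f -> Ck n g -> Ck n (fun x => f x + g x).
Proof.
  revert f g; induction n as [|n IH]; intros f g Hf Hg; [exact I|].
  destruct Hf as [Hf1 Hf2], Hg as [Hg1 Hg2].
  apply (Ck_is_derive n _ (fun x => Derive f x + Derive g x)); [|now apply IH].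
  intro x. apply @is_derive_plus; apply Derive_correct; auto.
Qed.

Lemma Ck_mult n f g : Ck n f -> Ck n g -> Ck n (fun x => f x * g x).
Proof.
  revert f g; induction n as [|n IH]; intros f g Hf Hg; [exact I|].
  pose proof (Ck_S _ _ Hf) as Hf0. pose proof (Ck_S _ _ Hg) as Hg0.
  destruct Hf as [Hf1 Hf2], Hg as [Hg1 Hg2].
  apply (Ck_is_derive n _ (fun x => Derive f x * g x + f x * Derive g x)).
  - intro x. apply @is_derive_mult; try (apply Derive_correct; auto). exact Rmult_comm.
  - apply Ck_plus; apply IH; auto.
Qed.

Lemma smooth_const c : smooth (fun _ => c).
Proof. apply smooth_Ck; intro; apply Ck_const. Qed.

Lemma smooth_plus f g : smooth f -> smooth g -> smooth (fun x => f x + g x).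
Proof. rewrite !smooth_Ck; intros; apply Ck_plus; auto. Qed.

Lemma smooth_mult f g : smooth f -> smooth g -> smooth (fun x => f x * g x).
Proof. rewrite !smooth_Ck; intros; apply Ck_mult; auto. Qed.

Lemma smooth_continuous f x : smooth f -> continuous f x.
Proof.
  intro H. apply (ex_derive_continuous (V := R_NormedModule) f).
  now apply smooth_ex_derive.
Qed.

Lemma ex_RInt_smooth f a b : smooth f -> ex_RInt f a b.
Proof.
  intro H. apply (ex_RInt_continuous (V := R_CompleteNormedModule)).
  intros; now apply smooth_continuous.
Qed.

(** * Periodic smooth functions *)

Lemma Cinf_smooth f : Cinf f -> smooth f.
Proof. now intros [_ H]. Qed.

Lemma Cinf_intro f : (forall x, f (x + 1) = f x) -> smooth f -> Cinf f.
Proof. now split. Qed.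

Lemma Cinf_ex_derive f : Cinf f -> forall x, ex_derive f x.
Proof. intros [_ H]; now apply smooth_ex_derive. Qed.

Lemma Cinf_Derive f : Cinf f -> Cinf (Derive f).
Proof.
  intros [Hp Hs]; split; [|now apply smooth_Derive].
  intro x.
  transitivity (Derive (fun y => f (y + 1)) x).
  - symmetry. apply is_derive_unique.
    evar_last; [apply (is_derive_comp (V := R_NormedModule) f (fun y => y + 1))|].
    + apply Derive_correct. now apply smooth_ex_derive.
    + auto_derive; [exact I|reflexivity].
    + unfold scal; simpl; unfold mult; simpl; ring.
  - apply Derive_ext. exact Hp.
Qed.

Lemma Cinf_const c : Cinf (fun _ => c).
Proof. split; [auto|apply smooth_const]. Qed.

Lemma Cinf_plus f g : Cinf f -> Cinf g -> Cinf (fun x => f x + g x).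
Proof.
  intros [Hf Hf'] [Hg Hg']; split; [intro; now rewrite Hf, Hg|now apply smooth_plus].
Qed.

Lemma Cinf_mult f g : Cinf f -> Cinf g -> Cinf (fun x => f x * g x).
Proof.
  intros [Hf Hf'] [Hg Hg']; split; [intro; now rewrite Hf, Hg|now apply smooth_mult].
Qed.

Lemma Cinf_scal c f : Cinf f -> Cinf (fun x => c * f x).
Proof. intro; apply Cinf_mult; [apply Cinf_const|auto]. Qed.

Lemma Cinf_opp f : Cinf f -> Cinf (fun x => - f x).
Proof.
  intro H. replace (fun x => - f x) with (fun x => -1 * f x); [now apply Cinf_scal|].
  apply functional_extensionality; intro; ring.
Qed.

Lemma Cinf_minus f g : Cinf f -> Cinf g -> Cinf (fun x => f x - g x).
Proof. intros; apply Cinf_plus; [|apply Cinf_opp]; auto. Qed.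

Lemma ex_RInt_Cinf f a b : Cinf f -> ex_RInt f a b.
Proof. intro; apply ex_RInt_smooth; now apply Cinf_smooth. Qed.

Lemma Derive_n_Cinf f n : Cinf f -> Cinf (Derive_n f n).
Proof.
  revert f; induction n as [|n IH]; intros f H; [exact H|].
  rewrite Derive_n_Derive. now apply IH, Cinf_Derive.
Qed.

Lemma Derive_plus_Cinf f g : Cinf f -> Cinf g ->
  Derive (fun x => f x + g x) = (fun x => Derive f x + Derive g x).
Proof.
  intros Hf Hg. apply functional_extensionality; intro.
  apply Derive_plus; now apply Cinf_ex_derive.
Qed.

Lemma Derive_scal_fun c f :
  Derive (fun x => c * f x) = (fun x => c * Derive f x).
Proof.
  apply functional_extensionality; intro. apply Derive_scal.
Qed.

Lemma Derive_mult_Cinf f g : Cinf f -> Cinf g ->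
  Derive (fun x => f x * g x) = (fun x => Derive f x * g x + f x * Derive g x).
Proof.
  intros Hf Hg. apply functional_extensionality; intro.
  apply Derive_mult; now apply Cinf_ex_derive.
Qed.

Lemma Derive_minus_Cinf f g : Cinf f -> Cinf g ->
  Derive (fun x => f x - g x) = (fun x => Derive f x - Derive g x).
Proof.
  intros Hf Hg. apply functional_extensionality; intro.
  apply Derive_minus; now apply Cinf_ex_derive.
Qed.

Lemma Derive_n_minus_Cinf f g n : Cinf f -> Cinf g ->
  Derive_n (fun x => f x - g x) n = (fun x => Derive_n f n x - Derive_n g n x).
Proof.
  revert f g; induction n as [|n IH]; intros f g Hf Hg; [reflexivity|].
  rewrite 3!Derive_n_Derive, Derive_minus_Cinf by auto.
  apply IH; now apply Cinf_Derive.
Qed.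

Lemma RInt_Derive_Cinf f : Cinf f -> RInt (Derive f) 0 1 = 0.
Proof.
  intro H. rewrite RInt_Derive.
  - generalize (proj1 H 0). rewrite Rplus_0_l. intros ->. apply Rminus_diag.
  - intros; now apply Cinf_ex_derive.
  - intros; now apply smooth_continuous, Cinf_smooth, Cinf_Derive.
Qed.

Lemma RInt_plus_R f g a b : ex_RInt f a b -> ex_RInt g a b ->
  RInt (fun x => f x + g x) a b = RInt f a b + RInt g a b.
Proof. intros; now apply @RInt_plus. Qed.

Lemma RInt_scal_R c f a b : ex_RInt f a b ->
  RInt (fun x => c * f x) a b = c * RInt f a b.
Proof. intros; now apply @RInt_scal. Qed.

Lemma RInt_by_parts f g : Cinf f -> Cinf g ->
  RInt (fun x => Derive f x * g x) 0 1 = - RInt (fun x => f x * Derive g x) 0 1.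
Proof.
  intros Hf Hg.
  pose proof (RInt_Derive_Cinf _ (Cinf_mult f g Hf Hg)) as H.
  rewrite Derive_mult_Cinf in H by auto.
  rewrite RInt_plus_R in H.
  - lra.
  - apply ex_RInt_Cinf, Cinf_mult; [apply Cinf_Derive|]; auto.
  - apply ex_RInt_Cinf, Cinf_mult; [|apply Cinf_Derive]; auto.
Qed.

(** * Bounds on the derivatives up to a given order *)

(** The [C^k] norm of [f] is at most [M].  The relational form avoids suprema. *)
Definition Cnorm_le (k : nat) (M : R) (f : R -> R) : Prop :=
  forall j x, (j <= k)%nat -> Rabs (Derive_n f j x) <= M.

Lemma Cnorm_le_S k M f : Cnorm_le (S k) M f <->
  (forall x, Rabs (f x) <= M) /\ Cnorm_le k M (Derive f).
Proof.
  split.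
  - intro H; split; [intro x; apply (H O); lia|].
    intros j x Hj. rewrite <- Derive_n_Derive. apply H; lia.
  - intros [H1 H2] [|j] x Hj; [apply H1|]. rewrite Derive_n_Derive. apply H2; lia.
Qed.

Lemma Cnorm_le_0 M f : Cnorm_le 0 M f <-> forall x, Rabs (f x) <= M.
Proof.
  split; [intros H x; apply (H O); lia|].
  intros H j x Hj. replace j with O by lia. apply H.
Qed.

Lemma Cnorm_le_pos k M f : Cnorm_le k M f -> 0 <= M.
Proof. intro H. apply Rle_trans with (2 := H O 0 (Nat.le_0_l k)), Rabs_pos. Qed.

Lemma Cnorm_le_le k k' M M' f : (k' <= k)%nat -> M <= M' -> Cnorm_le k M f -> Cnorm_le k' M' f.
Proof. intros Hk HM H j x Hj. apply Rle_trans with (2 := HM), H; lia. Qed.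

Lemma Cnorm_le_Derive k M f : Cnorm_le (S k) M f -> Cnorm_le k M (Derive f).
Proof. now rewrite Cnorm_le_S. Qed.

Lemma Cnorm_le_plus k M N f g : Cinf f -> Cinf g -> Cnorm_le k M f -> Cnorm_le k N g ->
  Cnorm_le k (M + N) (fun x => f x + g x).
Proof.
  revert f g; induction k as [|k IH]; intros f g Hf Hg HM HN.
  - rewrite Cnorm_le_0 in *. intro x. apply Rle_trans with (1 := Rabs_triang _ _).
    apply Rplus_le_compat; auto.
  - rewrite Cnorm_le_S in *. split.
    + intro x. apply Rle_trans with (1 := Rabs_triang _ _).
      apply Rplus_le_compat; [apply HM|apply HN].
    + rewrite Derive_plus_Cinf by auto. apply IH; try apply Cinf_Derive; tauto.
Qed.

(** Each application of the product rule doubles the number of terms. *)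
Lemma Cnorm_le_mult k M N f g : Cinf f -> Cinf g -> Cnorm_le k M f -> Cnorm_le k N g ->
  Cnorm_le k (2 ^ k * M * N) (fun x => f x * g x).
Proof.
  revert f g; induction k as [|k IH]; intros f g Hf Hg HM HN.
  - rewrite Cnorm_le_0 in *. intro x. rewrite Rabs_mult. simpl. rewrite Rmult_1_l.
    apply Rmult_le_compat; auto using Rabs_pos.
  - pose proof (Cnorm_le_pos _ _ _ HM). pose proof (Cnorm_le_pos _ _ _ HN).
    apply Cnorm_le_S; split.
    + intro x. rewrite Rabs_mult.
      apply Rle_trans with (M * N).
      * apply Rmult_le_compat; auto using Rabs_pos; [apply (HM O)|apply (HN O)]; lia.
      * rewrite Rmult_assoc. rewrite <- (Rmult_1_l (M * N)) at 1.
        apply Rmult_le_compat_r; [nra|]. apply pow_R1_Rle; lra.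
    + rewrite Derive_mult_Cinf by auto.
      replace (2 ^ S k * M * N) with (2 ^ k * M * N + 2 ^ k * M * N) by (simpl; ring).
      apply Cnorm_le_plus; try apply Cinf_mult; try apply Cinf_Derive; auto;
        apply IH; try apply Cinf_Derive; try apply Cnorm_le_Derive; auto;
        (eapply Cnorm_le_le; [| |eassumption]; [lia|lra]).
Qed.

Lemma Cnorm_le_scal k M c f : Cnorm_le k M f -> Cnorm_le k (Rabs c * M) (fun x => c * f x).
Proof.
  intros H j x Hj. rewrite Derive_n_scal_l, Rabs_mult.
  apply Rmult_le_compat_l; [apply Rabs_pos|]. now apply H.
Qed.

Lemma Cnorm_le_opp k M f : Cnorm_le k M f -> Cnorm_le k M (fun x => - f x).
Proof.
  intros H j x Hj. rewrite Derive_n_opp, Rabs_Ropp. now apply H.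
Qed.

Lemma periodic_nat (f : R -> R) (n : nat) x : (forall x, f (x + 1) = f x) -> f (x + INR n) = f x.
Proof.
  intro H. induction n as [|n IH]; [simpl; now rewrite Rplus_0_r|].
  rewrite S_INR, <- Rplus_assoc, H. exact IH.
Qed.

(** Sup norms of periodic functions are thereby controlled on a compact
    interval. *)
Lemma periodic_reduce (f : R -> R) x : (forall x, f (x + 1) = f x) ->
  exists y, 0 <= y <= 1 /\ f y = f x.
Proof.
  intro H. destruct (archimed x) as [A1 A2].
  destruct (Z_le_gt_dec 0 (up x - 1)) as [Hz|Hz].
  - exists (x - IZR (up x - 1)). rewrite minus_IZR. split; [lra|].
    rewrite <- (periodic_nat f (Z.to_nat (up x - 1)) (x - _)) by auto.
    f_equal. rewrite INR_IZR_INZ, Z2Nat.id by lia. rewrite minus_IZR; ring.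
  - exists (x - IZR (up x - 1)). rewrite minus_IZR. split; [lra|].
    rewrite <- (periodic_nat f (Z.to_nat (- (up x - 1))) x) by auto.
    f_equal. rewrite INR_IZR_INZ, Z2Nat.id by lia. rewrite opp_IZR, minus_IZR; ring.
Qed.

Lemma continuous_bounded (f : R -> R) a b : a <= b -> (forall x, a <= x <= b -> continuous f x) ->
  exists M, 0 <= M /\ forall x, a <= x <= b -> Rabs (f x) <= M.
Proof.
  intros Hab Hc.
  destruct (continuity_ab_maj (fun x => Rabs (f x)) a b Hab) as [m [Hm _]].
  - intros c Hc'. apply (continuity_pt_comp f Rabs); [|apply Rcontinuity_abs].
    apply continuity_pt_filterlim. now apply Hc.
  - exists (Rabs (f m)). split; [apply Rabs_pos|exact Hm].
Qed.

Lemma Cinf_bounded f : Cinf f -> exists M, forall x, Rabs (f x) <= M.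
Proof.
  intros H. destruct (continuous_bounded f 0 1) as [M [_ HM]]; [lra| |].
  - intros; now apply smooth_continuous, Cinf_smooth.
  - exists M. intro x. destruct (periodic_reduce f x (proj1 H)) as [y [Hy <-]]. auto.
Qed.

Lemma Cinf_Cnorm_le f k : Cinf f -> exists M, Cnorm_le k M f.
Proof.
  revert f; induction k as [|k IH]; intros f H; destruct (Cinf_bounded f H) as [M HM].
  - exists M. now rewrite Cnorm_le_0.
  - destruct (IH (Derive f)) as [N HN]; [now apply Cinf_Derive|].
    exists (Rmax M N). apply Cnorm_le_S. split.
    + intro x. apply Rle_trans with (1 := HM x), Rmax_l.
    + eapply Cnorm_le_le with (3 := HN); [lia|apply Rmax_r].
Qed.

(** * The Hilbert transform of a smooth function *)

Definition freq (n : nat) : R := 2 * PI * INR n.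
Definition cosn (n : nat) (x : R) : R := cos (freq n * x).
Definition sinn (n : nat) (x : R) : R := sin (freq n * x).

Lemma is_derive_cosn n x : is_derive (cosn n) x (- freq n * sinn n x).
Proof. unfold cosn, sinn. auto_derive; [exact I|ring]. Qed.

Lemma is_derive_sinn n x : is_derive (sinn n) x (freq n * cosn n x).
Proof. unfold cosn, sinn. auto_derive; [exact I|ring]. Qed.

Lemma Ck_trig k n : Ck k (cosn n) /\ Ck k (sinn n).
Proof.
  induction k as [|k [IH1 IH2]]; [split; exact I|]. split.
  - apply (Ck_is_derive k _ _ (is_derive_cosn n)), Ck_mult; auto using Ck_const.
  - apply (Ck_is_derive k _ _ (is_derive_sinn n)), Ck_mult; auto using Ck_const.
Qed.

Lemma freq_shift n x : freq n * (x + 1) = freq n * x + 2 * INR n * PI.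
Proof. unfold freq; ring. Qed.

Lemma Cinf_cosn n : Cinf (cosn n).
Proof.
  apply Cinf_intro; [|apply smooth_Ck; intro; apply Ck_trig].
  intro x. unfold cosn. now rewrite freq_shift, cos_period.
Qed.

Lemma Cinf_sinn n : Cinf (sinn n).
Proof.
  apply Cinf_intro; [|apply smooth_Ck; intro; apply Ck_trig].
  intro x. unfold sinn. now rewrite freq_shift, sin_period.
Qed.

Lemma cosn_bound n x : Rabs (cosn n x) <= 1.
Proof. apply Rabs_le, COS_bound. Qed.

Lemma sinn_bound n x : Rabs (sinn n x) <= 1.
Proof. apply Rabs_le, SIN_bound. Qed.

Definition ccoef (f : R -> R) (n : nat) : R := RInt (fun x => f x * cosn n x) 0 1.
Definition scoef (f : R -> R) (n : nat) : R := RInt (fun x => f x * sinn n x) 0 1.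

Lemma Derive_cosn n : Derive (cosn n) = fun x => - freq n * sinn n x.
Proof. apply is_derive_Derive, is_derive_cosn. Qed.

Lemma Derive_sinn n : Derive (sinn n) = fun x => freq n * cosn n x.
Proof. apply is_derive_Derive, is_derive_sinn. Qed.

(** Integration by parts turns [D] into multiplication by the frequency, with
    an exchange of the two families of coefficients. *)
Lemma ccoef_Derive f n : Cinf f -> ccoef (Derive f) n = freq n * scoef f n.
Proof.
  intro H. unfold ccoef, scoef.
  rewrite RInt_by_parts by auto using Cinf_cosn.
  rewrite Derive_cosn.
  rewrite <- RInt_scal_R by auto using ex_RInt_Cinf, Cinf_mult, Cinf_sinn.
  replace (fun x => f x * (- freq n * sinn n x))
    with (fun x => (-1) * (freq n * (f x * sinn n x)))
    by (apply functional_extensionality; intro; ring).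
  rewrite RInt_scal_R by auto 6 using ex_RInt_Cinf, Cinf_mult, Cinf_sinn, Cinf_scal.
  ring.
Qed.

Lemma scoef_Derive f n : Cinf f -> scoef (Derive f) n = - (freq n * ccoef f n).
Proof.
  intro H. unfold ccoef, scoef.
  rewrite RInt_by_parts by auto using Cinf_sinn.
  rewrite Derive_sinn.
  rewrite <- RInt_scal_R by auto using ex_RInt_Cinf, Cinf_mult, Cinf_cosn.
  f_equal. f_equal. apply functional_extensionality; intro; ring.
Qed.

Lemma RInt_unit_bound f M : Cinf f -> (forall x, Rabs (f x) <= M) ->
  Rabs (RInt f 0 1) <= M.
Proof.
  intros H HM. replace M with ((1 - 0) * M) by ring.
  apply abs_RInt_le_const; [lra|now apply ex_RInt_Cinf|auto].
Qed.

Lemma Rabs_mult_le_1 a b M : Rabs a <= M -> Rabs b <= 1 -> Rabs (a * b) <= M.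
Proof.
  intros Ha Hb. rewrite Rabs_mult, <- (Rmult_1_r M).
  apply Rmult_le_compat; auto using Rabs_pos.
Qed.

Lemma ccoef_bound f n M : Cinf f -> (forall x, Rabs (f x) <= M) -> Rabs (ccoef f n) <= M.
Proof.
  intros H HM. apply RInt_unit_bound; [apply Cinf_mult; auto using Cinf_cosn|].
  intro; apply Rabs_mult_le_1; auto using cosn_bound.
Qed.

Lemma scoef_bound f n M : Cinf f -> (forall x, Rabs (f x) <= M) -> Rabs (scoef f n) <= M.
Proof.
  intros H HM. apply RInt_unit_bound; [apply Cinf_mult; auto using Cinf_sinn|].
  intro; apply Rabs_mult_le_1; auto using sinn_bound.
Qed.

(** The real form of the modes [n] and [-n] of the Fourier series of [H f]. *)
Definition hterm (f : R -> R) (n : nat) (x : R) : R :=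
  2 * (ccoef f n * sinn n x - scoef f n * cosn n x).

Lemma is_derive_hterm f n x : Cinf f ->
  is_derive (hterm f n) x (hterm (Derive f) n x).
Proof.
  intro H. unfold hterm. rewrite ccoef_Derive, scoef_Derive by auto.
  unfold cosn, sinn. auto_derive; [exact I|ring].
Qed.

Lemma Cinf_hterm f n : Cinf (hterm f n).
Proof.
  apply Cinf_scal, Cinf_minus; apply Cinf_scal; auto using Cinf_cosn, Cinf_sinn.
Qed.

(** A telescoping substitute for [n^-2], whose partial sums are explicit. *)
Definition wt (n : nat) : R := / ((INR n + 1) * (INR n + 2)).

Lemma wt_pos n : 0 < wt n.
Proof.
  apply Rinv_0_lt_compat. pose proof (pos_INR n). nra.
Qed.

Lemma sum_wt N : sum_n wt N = 1 - / (INR N + 2).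
Proof.
  induction N as [|N IH].
  - rewrite sum_O. unfold wt; simpl; field.
  - rewrite sum_Sn, IH. unfold wt, plus; cbn [AbelianMonoid.plus]; simpl AbelianMonoid.plus.
    change (1 - / (INR N + 2) + / ((INR (S N) + 1) * (INR (S N) + 2)) = 1 - / (INR (S N) + 2)).
    rewrite S_INR. pose proof (pos_INR N). field. split; lra.
Qed.

Lemma is_lim_seq_inv_shift : is_lim_seq (fun N => / (INR N + 2)) 0.
Proof.
  replace (Finite 0) with (Rbar_inv p_infty) by reflexivity.
  apply is_lim_seq_inv; [|discriminate].
  eapply is_lim_seq_plus; [apply is_lim_seq_INR|apply is_lim_seq_const|reflexivity].
Qed.

Lemma is_series_wt : is_series wt 1.
Proof.
  change (is_lim_seq (sum_n wt) 1).
  apply is_lim_seq_ext with (fun N => 1 - / (INR N + 2)).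
  - intro; now rewrite sum_wt.
  - replace (Finite 1) with (Finite (1 - 0)) by (f_equal; ring).
    apply is_lim_seq_minus'; [apply is_lim_seq_const|apply is_lim_seq_inv_shift].
Qed.

Lemma ex_series_wt M a : (forall n, Rabs (a n) <= M * wt n) -> ex_series a.
Proof.
  intro H. apply @ex_series_le with (fun n => M * wt n); [exact H|].
  apply @ex_series_scal. exists 1; apply is_series_wt.
Qed.

Lemma Series_wt_bound M a : (forall n, Rabs (a n) <= M * wt n) -> Rabs (Series a) <= M.
Proof.
  intro H.
  assert (Hb : ex_series (fun n => M * wt n))
    by (apply @ex_series_scal; exists 1; apply is_series_wt).
  apply Rle_trans with (Series (fun n => Rabs (a n))).
  - apply Series_Rabs. apply @ex_series_le with (2 := Hb).
    intro n. simpl. unfold norm; simpl; unfold abs; simpl. rewrite Rabs_Rabsolu. apply H.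
  - apply Rle_trans with (Series (fun n => M * wt n)).
    + apply Series_le; [|exact Hb]. split; [apply Rabs_pos|apply H].
    + rewrite Series_scal_l, (is_series_unique _ _ is_series_wt). lra.
Qed.

Lemma freq_lower n : 6 * INR n <= freq n.
Proof.
  unfold freq. pose proof PI2_3_2. pose proof (pos_INR n). nra.
Qed.

Lemma freq_pos n : (0 < n)%nat -> 0 < freq n.
Proof. intro H. pose proof (freq_lower n). apply lt_INR in H. simpl in H. lra. Qed.

Lemma freq_0 : freq 0 = 0.
Proof. unfold freq; simpl; ring. Qed.

Lemma scoef_0 f : scoef f 0 = 0.
Proof.
  unfold scoef. replace (fun x => f x * sinn 0 x) with (fun _ : R => 0).
  - rewrite RInt_const. unfold scal; simpl; unfold mult; simpl; ring.
  - apply functional_extensionality; intro. unfold sinn.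
    rewrite freq_0, Rmult_0_l, sin_0. ring.
Qed.

Lemma hterm_0 f x : hterm f 0 x = 0.
Proof.
  unfold hterm, sinn. rewrite scoef_0, freq_0, Rmult_0_l, sin_0. ring.
Qed.

(** Two integrations by parts gain a factor [freq n ^ -2], which makes the
    series of [H f] normally convergent. *)
Lemma hterm_bound f M n x : Cinf f -> (forall y, Rabs (Derive (Derive f) y) <= M) ->
  Rabs (hterm f n x) <= M * wt n.
Proof.
  intros Hf HM.
  assert (H0M : 0 <= M) by (apply Rle_trans with (2 := HM 0), Rabs_pos).
  destruct n as [|n].
  { rewrite hterm_0, Rabs_R0. pose proof (wt_pos 0). nra. }
  assert (Hd : Cinf (Derive (Derive f))) by auto using Cinf_Derive.
  set (k := freq (S n)).
  assert (Hk : 6 * INR (S n) <= k) by apply freq_lower.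
  assert (Hn : 1 <= INR (S n)) by (rewrite S_INR; pose proof (pos_INR n); lra).
  (* The coefficients of [f] times [k * k] are, up to sign, those of [f'']. *)
  assert (Hb : Rabs (k * k * hterm f (S n) x) <= 4 * M).
  { replace (k * k * hterm f (S n) x) with
      (2 * (- ccoef (Derive (Derive f)) (S n) * sinn (S n) x
            + scoef (Derive (Derive f)) (S n) * cosn (S n) x)).
    - rewrite Rabs_mult, (Rabs_right 2) by lra.
      apply Rle_trans with (2 * (M + M)); [|lra].
      apply Rmult_le_compat_l; [lra|].
      apply Rle_trans with (1 := Rabs_triang _ _). apply Rplus_le_compat.
      + apply Rabs_mult_le_1; [rewrite Rabs_Ropp; now apply ccoef_bound|apply sinn_bound].
      + apply Rabs_mult_le_1; [now apply scoef_bound|apply cosn_bound].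
    - rewrite (ccoef_Derive (Derive f)), (scoef_Derive (Derive f)), (ccoef_Derive f),
        (scoef_Derive f) by auto using Cinf_Derive.
      unfold hterm. fold k. ring. }
  rewrite Rabs_mult, (Rabs_right (k * k)) in Hb by nra.
  unfold wt. set (h := Rabs _) in *.
  assert (0 <= h) by apply Rabs_pos.
  set (m := INR (S n)) in *.
  apply Rmult_le_reg_r with ((m + 1) * (m + 2)); [nra|].
  replace (M * / ((m + 1) * (m + 2)) * ((m + 1) * (m + 2))) with M by (field; split; lra).
  (* Since [k >= 6 m] and [m >= 1]. *)
  assert (4 * ((m + 1) * (m + 2)) <= k * k) by nra.
  nra.
Qed.

(** A single complex mode of the Fourier multiplier defining [H]; the modes
    [n] and [-n] are conjugate, and add up to [hterm f n]. *)
Definition zterm (f : R -> R) (n : Z) (x : R) : R :=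
  Re ((- (Ci * RtoC (IZR (Z.sgn n))))%C * fourier_coef f n
      * Cexp_i (2 * PI * IZR n * x))%C.

Lemma fourier_coef_pair f n : Cinf f ->
  fourier_coef f (Z.of_nat n) = (ccoef f n, - scoef f n) /\
  fourier_coef f (- Z.of_nat n) = (ccoef f n, scoef f n).
Proof.
  intro Hf. unfold fourier_coef.
  assert (Hc : is_RInt (fun x => f x * cosn n x) 0 1 (ccoef f n))
    by (apply (RInt_correct (V := R_CompleteNormedModule)), ex_RInt_Cinf, Cinf_mult;
        auto using Cinf_cosn).
  assert (Hs : is_RInt (fun x => f x * sinn n x) 0 1 (scoef f n))
    by (apply (RInt_correct (V := R_CompleteNormedModule)), ex_RInt_Cinf, Cinf_mult;
        auto using Cinf_sinn).
  assert (Hs' : is_RInt (fun x => - (f x * sinn n x)) 0 1 (- scoef f n))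
    by (apply @is_RInt_opp; exact Hs).
  split; apply (is_RInt_unique (V := C_R_CompleteNormedModule));
    apply @is_RInt_fct_extend_pair; simpl.
  - apply is_RInt_ext with (2 := Hc). intros x _. rewrite <- INR_IZR_INZ.
    replace (- (2 * PI * INR n * x)) with (- (freq n * x)) by (unfold freq; ring).
    rewrite cos_neg, sin_neg. unfold cosn. eq_R. ring.
  - apply is_RInt_ext with (2 := Hs'). intros x _. rewrite <- INR_IZR_INZ.
    replace (- (2 * PI * INR n * x)) with (- (freq n * x)) by (unfold freq; ring).
    rewrite cos_neg, sin_neg. unfold sinn. eq_R. ring.
  - apply is_RInt_ext with (2 := Hc). intros x _. rewrite opp_IZR, <- INR_IZR_INZ.
    replace (- (2 * PI * - INR n * x)) with (freq n * x) by (unfold freq; ring).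
    unfold cosn. eq_R. ring.
  - apply is_RInt_ext with (2 := Hs). intros x _. rewrite opp_IZR, <- INR_IZR_INZ.
    replace (- (2 * PI * - INR n * x)) with (freq n * x) by (unfold freq; ring).
    unfold sinn. eq_R. ring.
Qed.

Lemma zterm_pair f n x : Cinf f ->
  zterm f (Z.of_nat (S n)) x + zterm f (- Z.of_nat (S n)) x = hterm f (S n) x.
Proof.
  intro Hf. destruct (fourier_coef_pair f (S n) Hf) as [H1 H2].
  unfold zterm. rewrite H1, H2.
  rewrite opp_IZR, <- INR_IZR_INZ.
  replace (Z.sgn (Z.of_nat (S n))) with 1%Z by lia.
  replace (Z.sgn (- Z.of_nat (S n))) with (-1)%Z by lia.
  replace (2 * PI * - INR (S n) * x) with (- (freq (S n) * x)) by (unfold freq; ring).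
  replace (2 * PI * INR (S n) * x) with (freq (S n) * x) by (unfold freq; ring).
  unfold hterm, cosn, sinn. cbn -[INR freq ccoef scoef].
  rewrite cos_neg, sin_neg. ring.
Qed.

(** From [N] to [N + 1] the symmetric sum gains one mode at each end. *)
Lemma sum_zterm f N x : Cinf f ->
  sum_n (fun k => zterm f (Z.of_nat k - Z.of_nat N) x) (2 * N)
  = sum_n (fun n => hterm f n x) N.
Proof.
  intro Hf. induction N as [|N IH].
  - rewrite !sum_O, hterm_0. unfold zterm; simpl. ring.
  - rewrite sum_Sn, <- IH.
    replace (2 * S N)%nat with (S (S (2 * N))) by lia.
    rewrite sum_Sn.
    unfold sum_n at 1. rewrite sum_Sn_m, <- sum_n_m_S by lia.
    rewrite (sum_n_m_ext _ (fun k => zterm f (Z.of_nat k - Z.of_nat N) x))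
      by (intro k; f_equal; lia).
    fold (sum_n (fun k => zterm f (Z.of_nat k - Z.of_nat N) x) (2 * N)).
    rewrite <- (zterm_pair f N x Hf).
    replace (Z.of_nat 0 - Z.of_nat (S N))%Z with (- Z.of_nat (S N))%Z by lia.
    replace (Z.of_nat (S (S (2 * N))) - Z.of_nat (S N))%Z with (Z.of_nat (S N)) by lia.
    unfold plus; simpl AbelianMonoid.plus. cbn -[sum_n zterm Z.of_nat]. ring.
Qed.

Lemma Re_sum_n (a : nat -> C) N : Re (sum_n a N) = sum_n (fun n => Re (a n)) N.
Proof.
  induction N as [|N IH]; [now rewrite !sum_O|].
  rewrite !sum_Sn, <- IH. reflexivity.
Qed.

Lemma Re_CLim_seq s : Re (CLim_seq s) = real (Lim_seq (fun N => Re (s N))).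
Proof. reflexivity. Qed.

Lemma Hilbert_Series f x : Cinf f -> Hilbert f x = Series (fun n => hterm f n x).
Proof.
  intro Hf. unfold Hilbert, fourier_multiplier, Series. rewrite Re_CLim_seq.
  f_equal. apply Lim_seq_ext. intro N. rewrite <- sum_zterm by auto.
  etransitivity; [apply Re_sum_n|]. reflexivity.
Qed.

(** * Uniqueness of Fourier coefficients *)

Definition fourier_null (f : R -> R) : Prop :=
  Cinf f /\ forall n, ccoef f n = 0 /\ scoef f n = 0.

Lemma ccoef_plus f g n : Cinf f -> Cinf g ->
  ccoef (fun x => f x + g x) n = ccoef f n + ccoef g n.
Proof.
  intros Hf Hg. unfold ccoef.
  rewrite <- RInt_plus_R by auto using ex_RInt_Cinf, Cinf_mult, Cinf_cosn.
  f_equal. apply functional_extensionality; intro; ring.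
Qed.

Lemma scoef_plus f g n : Cinf f -> Cinf g ->
  scoef (fun x => f x + g x) n = scoef f n + scoef g n.
Proof.
  intros Hf Hg. unfold scoef.
  rewrite <- RInt_plus_R by auto using ex_RInt_Cinf, Cinf_mult, Cinf_sinn.
  f_equal. apply functional_extensionality; intro; ring.
Qed.

Lemma ccoef_scal c f n : Cinf f -> ccoef (fun x => c * f x) n = c * ccoef f n.
Proof.
  intros Hf. unfold ccoef.
  rewrite <- RInt_scal_R by auto using ex_RInt_Cinf, Cinf_mult, Cinf_cosn.
  f_equal. apply functional_extensionality; intro; ring.
Qed.

Lemma scoef_scal c f n : Cinf f -> scoef (fun x => c * f x) n = c * scoef f n.
Proof.
  intros Hf. unfold scoef.
  rewrite <- RInt_scal_R by auto using ex_RInt_Cinf, Cinf_mult, Cinf_sinn.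
  f_equal. apply functional_extensionality; intro; ring.
Qed.

Lemma fourier_null_plus f g : fourier_null f -> fourier_null g ->
  fourier_null (fun x => f x + g x).
Proof.
  intros [Hf Hf'] [Hg Hg']; split; [now apply Cinf_plus|]. intro n.
  destruct (Hf' n) as [E1 E2], (Hg' n) as [E3 E4].
  rewrite ccoef_plus, scoef_plus, E1, E2, E3, E4 by auto. lra.
Qed.

Lemma fourier_null_scal c f : fourier_null f -> fourier_null (fun x => c * f x).
Proof.
  intros [Hf Hf']; split; [now apply Cinf_scal|]. intro n.
  destruct (Hf' n) as [E1 E2].
  rewrite ccoef_scal, scoef_scal, E1, E2 by auto. lra.
Qed.

Lemma freq_S n : freq (S n) = freq n + freq 1.
Proof. unfold freq. rewrite S_INR. simpl. ring. Qed.

Lemma RInt_lincomb f a b g h : Cinf f -> Cinf g -> Cinf h ->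
  RInt (fun x => f x * (a * g x + b * h x)) 0 1
  = a * RInt (fun x => f x * g x) 0 1 + b * RInt (fun x => f x * h x) 0 1.
Proof.
  intros. rewrite <- !RInt_scal_R, <- RInt_plus_R
    by auto using ex_RInt_Cinf, Cinf_mult, Cinf_scal.
  f_equal. apply functional_extensionality; intro; ring.
Qed.

(** Multiplication by the first harmonic shifts frequencies by one in either
    direction.  Starting at [S n] keeps all frequencies natural numbers. *)
Lemma trig_product n x :
  cosn 1 x * cosn (S n) x = / 2 * cosn (S (S n)) x + / 2 * cosn n x /\
  cosn 1 x * sinn (S n) x = / 2 * sinn (S (S n)) x + / 2 * sinn n x /\
  sinn 1 x * cosn (S n) x = / 2 * sinn (S (S n)) x + - / 2 * sinn n x /\
  sinn 1 x * sinn (S n) x = - / 2 * cosn (S (S n)) x + / 2 * cosn n x.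
Proof.
  unfold cosn, sinn.
  replace (freq (S (S n)) * x) with (freq (S n) * x + freq 1 * x)
    by (rewrite (freq_S (S n)); ring).
  replace (freq n * x) with (freq (S n) * x - freq 1 * x) by (rewrite (freq_S n); ring).
  rewrite cos_plus, cos_minus, sin_plus, sin_minus.
  repeat split; field.
Qed.

Lemma cosn_0 x : cosn 0 x = 1.
Proof. unfold cosn. now rewrite freq_0, Rmult_0_l, cos_0. Qed.

Lemma sinn_0 x : sinn 0 x = 0.
Proof. unfold sinn. now rewrite freq_0, Rmult_0_l, sin_0. Qed.

Lemma RInt_unit_ext (f g : R -> R) : (forall x, f x = g x) -> RInt f 0 1 = RInt g 0 1.
Proof. intro H. f_equal. now apply functional_extensionality. Qed.

(** The coefficients of [f cosn 1] and [f sinn 1] are combinations of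
    coefficients of [f]. *)
Lemma fourier_null_mult_trig f : fourier_null f ->
  fourier_null (fun x => f x * cosn 1 x) /\ fourier_null (fun x => f x * sinn 1 x).
Proof.
  intros [Hf H].
  assert (Hz : forall a b n m, RInt (fun x => f x * (a * cosn n x + b * cosn m x)) 0 1 = 0).
  { intros. rewrite RInt_lincomb by auto using Cinf_cosn.
    fold (ccoef f n) (ccoef f m). rewrite !(proj1 (H _)). eq_R; ring. }
  assert (Hz' : forall a b n m, RInt (fun x => f x * (a * sinn n x + b * sinn m x)) 0 1 = 0).
  { intros. rewrite RInt_lincomb by auto using Cinf_sinn.
    fold (scoef f n) (scoef f m). rewrite !(proj2 (H _)). eq_R; ring. }
  split; (split; [auto using Cinf_mult, Cinf_cosn, Cinf_sinn|]); intros [|n];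
    (split; [unfold ccoef|unfold scoef]).
  - etransitivity; [|exact (Hz 1 0 1%nat 1%nat)]. apply RInt_unit_ext; intro. rewrite cosn_0. ring.
  - etransitivity; [|exact (Hz 0 0 1%nat 1%nat)]. apply RInt_unit_ext; intro. rewrite sinn_0. ring.
  - etransitivity; [|exact (Hz (/ 2) (/ 2) (S (S n)) n)]. apply RInt_unit_ext; intro.
    rewrite Rmult_assoc. f_equal. apply trig_product.
  - etransitivity; [|exact (Hz' (/ 2) (/ 2) (S (S n)) n)]. apply RInt_unit_ext; intro.
    rewrite Rmult_assoc. f_equal. apply trig_product.
  - etransitivity; [|exact (Hz' 1 0 1%nat 1%nat)]. apply RInt_unit_ext; intro. rewrite cosn_0. ring.
  - etransitivity; [|exact (Hz 0 0 1%nat 1%nat)]. apply RInt_unit_ext; intro. rewrite sinn_0. ring.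
  - etransitivity; [|exact (Hz' (/ 2) (- / 2) (S (S n)) n)]. apply RInt_unit_ext; intro.
    rewrite Rmult_assoc. f_equal. apply trig_product.
  - etransitivity; [|exact (Hz (- / 2) (/ 2) (S (S n)) n)]. apply RInt_unit_ext; intro.
    rewrite Rmult_assoc. f_equal. apply trig_product.
Qed.

(** This is [cos^2 (pi (x - x0))]: nonnegative, equal to 1 at [x0] and
    smaller elsewhere in the period, and a trigonometric polynomial. *)
Definition peak (x0 x : R) : R := / 2 + / 2 * cos (freq 1 * (x - x0)).

Lemma peak_eq x0 x :
  peak x0 x = / 2 + (/ 2 * cosn 1 x0 * cosn 1 x + / 2 * sinn 1 x0 * sinn 1 x).
Proof.
  unfold peak, cosn, sinn. rewrite Rmult_minus_distr_l, cos_minus. ring.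
Qed.

Lemma Cinf_peak x0 : Cinf (peak x0).
Proof.
  replace (peak x0) with
    (fun x => / 2 + (/ 2 * cosn 1 x0 * cosn 1 x + / 2 * sinn 1 x0 * sinn 1 x))
    by (apply functional_extensionality; intro; now rewrite peak_eq).
  auto 6 using Cinf_plus, Cinf_scal, Cinf_const, Cinf_cosn, Cinf_sinn.
Qed.

Lemma Cinf_pow f k : Cinf f -> Cinf (fun x => f x ^ k).
Proof.
  intro H. induction k as [|k IH]; simpl; [apply Cinf_const|now apply Cinf_mult].
Qed.

Lemma fourier_null_mult_peak f x0 k : fourier_null f ->
  fourier_null (fun x => f x * peak x0 x ^ k).
Proof.
  intro H. induction k as [|k IH].
  - replace (fun x => f x * peak x0 x ^ 0) with f; [exact H|].
    apply functional_extensionality; intro; simpl; ring.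
  - set (g := fun x => f x * peak x0 x ^ k) in *.
    destruct (fourier_null_mult_trig g IH) as [Hc Hs].
    replace (fun x => f x * peak x0 x ^ S k) with
      (fun x => / 2 * g x + (/ 2 * cosn 1 x0 * (g x * cosn 1 x)
                             + / 2 * sinn 1 x0 * (g x * sinn 1 x))).
    + apply (fourier_null_plus (fun x => / 2 * g x)); [now apply fourier_null_scal|].
      apply (fourier_null_plus (fun x => / 2 * cosn 1 x0 * (g x * cosn 1 x)));
        now apply fourier_null_scal.
    + apply functional_extensionality; intro. unfold g.
      rewrite <- tech_pow_Rmult. set (p := peak x0 _ ^ k). rewrite peak_eq. ring.
Qed.

Lemma peak_bound x0 x : 0 <= peak x0 x <= 1.
Proof. unfold peak. pose proof (COS_bound (freq 1 * (x - x0))). lra. Qed.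

(** Wallis' recursion: integrate the derivative of [s * peak ^ k] over a
    period, with [s] the sine of argument [2 pi (x - x0)], and use
    [s^2 = 4 (peak - peak^2)]. *)
Lemma RInt_peak_rec x0 k :
  RInt (fun x => peak x0 x ^ S k) 0 1 * (2 * INR k + 2)
  = RInt (fun x => peak x0 x ^ k) 0 1 * (2 * INR k + 1).
Proof.
  set (s := fun x => sin (freq 1 * (x - x0))).
  assert (Hs : Cinf s).
  { replace s with (fun x => cosn 1 x0 * sinn 1 x + - sinn 1 x0 * cosn 1 x).
    - apply Cinf_plus; apply Cinf_scal; auto using Cinf_cosn, Cinf_sinn.
    - apply functional_extensionality; intro. unfold s, cosn, sinn.
      rewrite Rmult_minus_distr_l, sin_minus. ring. }
  pose proof (Cinf_pow _ k (Cinf_peak x0)) as Hk.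
  pose proof (Cinf_pow _ (S k) (Cinf_peak x0)) as HSk.
  pose proof (RInt_Derive_Cinf _ (Cinf_mult _ _ Hs Hk)) as H.
  cbv beta in H.
  replace (Derive (fun x => s x * peak x0 x ^ k)) with
    (fun x => freq 1 * ((2 * INR k + 2) * peak x0 x ^ S k)
              + - freq 1 * ((2 * INR k + 1) * peak x0 x ^ k)) in H.
  - rewrite RInt_plus_R, !RInt_scal_R in H by auto 6 using ex_RInt_Cinf, Cinf_scal.
    pose proof (freq_pos 1 ltac:(lia)). nra.
  - symmetry. apply is_derive_Derive. intro x.
    assert (Hp : is_derive (peak x0) x (- (freq 1 / 2) * s x)).
    { unfold peak, s. auto_derive; [exact I|unfold Rdiv, Rminus; ring]. }
    assert (Hs' : is_derive s x (freq 1 * (2 * peak x0 x - 1))).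
    { unfold peak, s. auto_derive; [exact I|unfold Rminus; field]. }
    pose proof (is_derive_pow _ k _ _ Hp) as Hpk.
    evar_last; [exact (is_derive_mult _ _ _ _ _ Hs' Hpk Rmult_comm)|].
    unfold plus, mult; simpl.
    assert (E : s x * s x = 4 * peak x0 x - 4 * (peak x0 x * peak x0 x)).
    { unfold peak, s. set (y := freq 1 * (x - x0)).
      pose proof (sin2_cos2 y) as E. unfold Rsqr in E. lra. }
    destruct k as [|k]; [simpl; ring|].
    simpl pred. rewrite S_INR.
    transitivity (freq 1 * (2 * peak x0 x - 1) * (peak x0 x * peak x0 x ^ k)
      - (INR k + 1) * (freq 1 / 2) * peak x0 x ^ k * (s x * s x)).
    + simpl; field.
    + rewrite E. simpl; field.
Qed.

Lemma RInt_peak_pos x0 k : 0 < RInt (fun x => peak x0 x ^ k) 0 1.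
Proof.
  induction k as [|k IH].
  - simpl. rewrite RInt_const. unfold scal; simpl; unfold mult; simpl. lra.
  - pose proof (RInt_peak_rec x0 k). pose proof (pos_INR k).
    set (I0 := RInt _ _ _) in *. set (I1 := RInt (fun x => peak x0 x ^ S k) 0 1) in *. nra.
Qed.

Lemma RInt_le_Cinf f g : Cinf f -> Cinf g -> (forall x, f x <= g x) ->
  RInt f 0 1 <= RInt g 0 1.
Proof. intros; apply RInt_le; auto using ex_RInt_Cinf. lra. Qed.

(** Near [x0] the function exceeds [f x0 / 2]; away from [x0] the quantity
    [1 - peak] is bounded below, so that a large multiple of it absorbs [f]. *)
Lemma peak_lower_bound f x0 : Cinf f -> 0 < f x0 ->
  exists K, 0 <= K /\ forall x, f x0 / 2 - K * (1 - peak x0 x) <= f x.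
Proof.
  intros Hf Hpos.
  assert (Hd : exists d, 0 < d < / 2 /\ forall y, Rabs y < d -> f x0 / 2 <= f (x0 + y)).
  { assert (Hc := smooth_continuous f x0 (Cinf_smooth _ Hf)).
    destruct (Hc (fun v => f x0 / 2 <= v)) as [e He].
    - exists (mkposreal (f x0 / 2) ltac:(lra)). intros v Hv.
      change (Rabs (v - f x0) < f x0 / 2) in Hv. apply Rabs_def2 in Hv. lra.
    - exists (Rmin e (/ 4)). pose proof (cond_pos e). split.
      + split; [apply Rmin_glb_lt; lra|]. pose proof (Rmin_r e (/ 4)). lra.
      + intros y Hy. apply He. change (Rabs (x0 + y - x0) < e).
        replace (x0 + y - x0) with y by ring.
        apply Rlt_le_trans with (1 := Hy), Rmin_l. }
  destruct Hd as [d [Hd Hnear]].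
  destruct (Cinf_bounded f Hf) as [M HM].
  (* At distance at least [d] from [x0] in the period, [1 - peak >= (1 - q) / 2]. *)
  set (q := cos (freq 1 * d)).
  assert (Hfr : freq 1 = 2 * PI) by (unfold freq; simpl; ring).
  pose proof PI_RGT_0 as HPI.
  assert (Hq : q < 1).
  { unfold q. rewrite <- cos_0. apply cos_decreasing_1; rewrite ?Hfr; nra. }
  assert (HM0 : 0 <= M) by (apply Rle_trans with (2 := HM 0), Rabs_pos).
  exists ((M + f x0 / 2) * 2 / (1 - q)).
  assert (HK : 0 <= (M + f x0 / 2) * 2 / (1 - q)).
  { apply Rmult_le_pos; [lra|]. left; apply Rinv_0_lt_compat; lra. }
  split; [exact HK|]. intro x.
  set (g := fun y => f (x0 + y) + (M + f x0 / 2) * 2 / (1 - q) * (1 - peak x0 (x0 + y))).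
  enough (Hg : forall x, f x0 / 2 <= g x).
  { specialize (Hg (x - x0)). unfold g in Hg. replace (x0 + (x - x0)) with x in Hg by ring.
    lra. }
  clear x. intro x.
  assert (Hper : forall x, g (x + 1) = g x).
  { intro z. unfold g. rewrite <- Rplus_assoc, (proj1 Hf), (proj1 (Cinf_peak x0)).
    reflexivity. }
  (* The representative is taken in [x0 - 1/2, x0 + 1/2], where [cos] is
     monotone in the distance to [x0]. *)
  destruct (periodic_reduce (fun y => g (y - / 2)) (x + / 2)) as [y [Hy E]].
  { intro z. rewrite <- (Hper (z - / 2)). f_equal. ring. }
  replace (x + / 2 - / 2) with x in E by ring. rewrite <- E.
  set (z := y - / 2). assert (Hz : -/2 <= z <= / 2) by (unfold z; lra).
  unfold g. pose proof (peak_bound x0 (x0 + z)).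
  destruct (Rlt_le_dec (Rabs z) d) as [Hlt|Hge].
  - specialize (Hnear z Hlt).
    assert (0 <= (M + f x0 / 2) * 2 / (1 - q) * (1 - peak x0 (x0 + z)))
      by (apply Rmult_le_pos; lra). lra.
  - assert (Hpk : peak x0 (x0 + z) <= / 2 + / 2 * q).
    { unfold peak. replace (x0 + z - x0) with z by ring.
      replace (cos (freq 1 * z)) with (cos (freq 1 * Rabs z)).
      - assert (cos (freq 1 * Rabs z) <= q); [|lra].
        assert (Rabs z <= / 2) by (apply Rabs_le; lra).
        unfold q. apply cos_decr_1; rewrite ?Hfr; nra.
      - unfold Rabs; destruct (Rcase_abs z); [|reflexivity].
        rewrite <- cos_neg. f_equal; ring. }
    assert (M + f x0 / 2 <= (M + f x0 / 2) * 2 / (1 - q) * (1 - peak x0 (x0 + z))).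
    { apply Rle_trans with ((M + f x0 / 2) * 2 / (1 - q) * ((1 - q) / 2)).
      - right; field; lra.
      - apply Rmult_le_compat_l; lra. }
    pose proof (HM (x0 + z)) as HMz. apply Rabs_le_between in HMz. lra.
Qed.

(** Let [I_k] be the integral of [peak ^ k] and suppose [c = f x0 / 2] positive.
    As [f] is orthogonal to [peak ^ k], the bound [f >= c - K (1 - peak)] gives
    [c I_k <= K (I_k - I_{k+1})].  By Wallis' recursion the right-hand side is
    [K I_k / (2 k + 2)], which is absurd for large [k]. *)
Lemma fourier_null_nonpos f x0 : fourier_null f -> f x0 <= 0.
Proof.
  intro H. destruct (Rle_lt_dec (f x0) 0) as [|Hpos]; [assumption|exfalso].
  pose proof (proj1 H) as Hf.
  destruct (peak_lower_bound f x0 Hf Hpos) as [K [HK Hlow]].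
  assert (Hall : forall k, f x0 / 2 * (2 * INR k + 2) <= K).
  { intro k.
    assert (E : RInt (fun x => f x * peak x0 x ^ k) 0 1 = 0).
    { etransitivity; [|exact (proj1 (proj2 (fourier_null_mult_peak f x0 k H) O))].
      unfold ccoef. apply RInt_unit_ext; intro. rewrite cosn_0; ring. }
    pose proof (Cinf_pow _ k (Cinf_peak x0)) as Hk.
    pose proof (Cinf_pow _ (S k) (Cinf_peak x0)) as HSk.
    assert (L : RInt (fun x => (f x0 / 2 - K) * peak x0 x ^ k + K * peak x0 x ^ S k) 0 1
                <= RInt (fun x => f x * peak x0 x ^ k) 0 1).
    { apply RInt_le_Cinf; auto using Cinf_plus, Cinf_scal, Cinf_mult.
      intro x. specialize (Hlow x).
      assert (0 <= peak x0 x ^ k) by (apply pow_le, peak_bound).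
      simpl. nra. }
    rewrite E, RInt_plus_R, !RInt_scal_R in L by auto using ex_RInt_Cinf, Cinf_scal.
    pose proof (RInt_peak_rec x0 k) as Hrec. pose proof (RInt_peak_pos x0 k) as Hp.
    pose proof (pos_INR k).
    set (I0 := RInt (fun x => peak x0 x ^ k) 0 1) in *.
    set (I1 := RInt (fun x => peak x0 x ^ S k) 0 1) in *.
    assert (0 >= (f x0 / 2 - K) * I0 * (2 * INR k + 2) + K * (I1 * (2 * INR k + 2))) by nra.
    rewrite Hrec in *. apply Rmult_le_reg_r with I0; [exact Hp|]. nra. }
  destruct (INR_unbounded (K / f x0)) as [n Hn].
  specialize (Hall n).
  assert (K < INR n * f x0).
  { apply Rmult_lt_reg_r with (/ f x0); [now apply Rinv_0_lt_compat|].
    replace (INR n * f x0 * / f x0) with (INR n) by (field; lra). exact Hn. }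
  lra.
Qed.

Lemma fourier_null_eq_0 f x : fourier_null f -> f x = 0.
Proof.
  intro H. apply Rle_antisym; [now apply fourier_null_nonpos|].
  pose proof (fourier_null_nonpos _ x (fourier_null_scal (-1) f H)). simpl in *. lra.
Qed.

(** * Algebraic and analytic properties of the Hilbert transform *)

Lemma Hilbert_bound f M x : Cinf f -> (forall y, Rabs (Derive (Derive f) y) <= M) ->
  Rabs (Hilbert f x) <= M.
Proof.
  intros Hf HM. rewrite Hilbert_Series by auto.
  apply Series_wt_bound. intro n. now apply hterm_bound.
Qed.

Lemma ex_series_hterm f x : Cinf f -> ex_series (fun n => hterm f n x).
Proof.
  intro Hf. destruct (Cinf_bounded (Derive (Derive f))) as [M HM];
    [auto using Cinf_Derive|].
  apply ex_series_wt with M. intro n. now apply hterm_bound.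
Qed.

Lemma hterm_plus f g n x : Cinf f -> Cinf g ->
  hterm (fun x => f x + g x) n x = hterm f n x + hterm g n x.
Proof. intros. unfold hterm. rewrite ccoef_plus, scoef_plus by auto. ring. Qed.

Lemma hterm_scal c f n x : Cinf f -> hterm (fun x => c * f x) n x = c * hterm f n x.
Proof. intros. unfold hterm. rewrite ccoef_scal, scoef_scal by auto. ring. Qed.

Lemma Hilbert_plus f g : Cinf f -> Cinf g ->
  Hilbert (fun x => f x + g x) = (fun x => Hilbert f x + Hilbert g x).
Proof.
  intros. apply functional_extensionality; intro x.
  rewrite !Hilbert_Series, <- Series_plus by auto using Cinf_plus, ex_series_hterm.
  apply Series_ext; intro n. now apply hterm_plus.
Qed.

Lemma Hilbert_scal c f : Cinf f ->
  Hilbert (fun x => c * f x) = (fun x => c * Hilbert f x).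
Proof.
  intros. apply functional_extensionality; intro x.
  rewrite !Hilbert_Series, <- Series_scal_l by auto using Cinf_scal.
  apply Series_ext; intro n. now apply hterm_scal.
Qed.

(** The uniform Taylor estimate behind termwise differentiation: summing it
    over the modes, no separate argument of uniform convergence is needed. *)
Lemma second_order_bound (f f' f'' : R -> R) M x h :
  (forall y, is_derive f y (f' y)) -> (forall y, is_derive f' y (f'' y)) ->
  (forall y, Rabs (f'' y) <= M) -> Rabs (f (x + h) - f x - h * f' x) <= M * (h * h).
Proof.
  intros H1 H2 HM.
  assert (HC : forall g g' : R -> R, (forall y, is_derive g y (g' y)) ->
    forall y, continuity_pt g y).
  { intros g g' Hg y. apply continuity_pt_filterlim.
    apply (ex_derive_continuous (V := R_NormedModule) g). eexists; apply Hg. }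
  destruct (MVT_gen f x (x + h) f') as [c [Hc E]]; eauto.
  destruct (MVT_gen f' x c f'') as [d [Hd E']]; eauto.
  replace (f (x + h) - f x - h * f' x) with (f'' d * ((c - x) * h)) by (rewrite E; nra).
  rewrite Rabs_mult. apply Rmult_le_compat; auto using Rabs_pos.
  rewrite Rabs_mult.
  apply Rle_trans with (Rabs h * Rabs h).
  - apply Rmult_le_compat_r; [apply Rabs_pos|].
    revert Hc. unfold Rmin, Rmax. repeat destruct Rle_dec; intro;
      apply Rabs_le; split_Rabs; lra.
  - right. rewrite <- Rabs_mult. apply Rabs_right. nra.
Qed.

Lemma is_derive_quadratic f x l M :
  (forall h, Rabs (f (x + h) - f x - h * l) <= M * (h * h)) -> is_derive f x l.
Proof.
  intro H. apply is_derive_Reals. intros e He.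
  assert (HM : 0 <= M).
  { specialize (H 1). apply Rle_trans with (M * (1 * 1)); [|lra].
    apply Rle_trans with (2 := H), Rabs_pos. }
  exists (mkposreal (e / (M + 1)) ltac:(apply Rdiv_lt_0_compat; lra)).
  intros h Hh0 Hh. simpl in Hh.
  replace ((f (x + h) - f x) / h - l) with ((f (x + h) - f x - h * l) * / h)
    by (field; auto).
  rewrite Rabs_mult, Rabs_inv. specialize (H h).
  pose proof (Rabs_pos_lt h Hh0).
  apply Rmult_lt_reg_r with (Rabs h); [auto|].
  rewrite Rmult_assoc, Rinv_l, Rmult_1_r by lra.
  apply Rle_lt_trans with (1 := H).
  replace (h * h) with (Rabs h * Rabs h)
    by (rewrite <- Rabs_mult; apply Rabs_right; nra).
  assert (Rabs h * (M + 1) < e).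
  { replace e with (e / (M + 1) * (M + 1)) by (field; lra).
    apply Rmult_lt_compat_r; lra. }
  nra.
Qed.

(** The second order Taylor remainders of the modes are bounded by the summable
    [M * wt n] times [h ^ 2], where [M] bounds the fourth derivative of [f]. *)
Lemma is_derive_Hilbert f x : Cinf f -> is_derive (Hilbert f) x (Hilbert (Derive f) x).
Proof.
  intro Hf.
  assert (Hf1 : Cinf (Derive f)) by auto using Cinf_Derive.
  assert (Hf2 : Cinf (Derive (Derive f))) by auto using Cinf_Derive.
  destruct (Cinf_bounded (Derive (Derive (Derive (Derive f))))) as [M HM];
    [auto using Cinf_Derive|].
  apply is_derive_quadratic with M. intro h.
  rewrite !Hilbert_Series by auto.
  rewrite <- Series_scal_l, <- !Series_minus; auto using ex_series_hterm.
  - rewrite Rmult_comm, <- (Rmult_comm M).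
    apply Series_wt_bound. intro n.
    replace (M * (h * h) * wt n) with (M * wt n * (h * h)) by ring.
    apply second_order_bound with (hterm (Derive (Derive f)) n); intro y.
    + now apply is_derive_hterm.
    + now apply is_derive_hterm.
    + now apply hterm_bound.
  - apply @ex_series_minus; auto using ex_series_hterm.
  - apply (ex_series_scal h (fun n => hterm (Derive f) n x)). auto using ex_series_hterm.
Qed.

Lemma Derive_Hilbert f : Cinf f -> Derive (Hilbert f) = Hilbert (Derive f).
Proof. intro; apply is_derive_Derive; intro; now apply is_derive_Hilbert. Qed.

Lemma Derive_n_Hilbert f n : Cinf f -> Derive_n (Hilbert f) n = Hilbert (Derive_n f n).
Proof.
  revert f; induction n as [|n IH]; intros f Hf; [reflexivity|].
  rewrite 2!Derive_n_Derive, Derive_Hilbert by auto. apply IH, Cinf_Derive, Hf.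
Qed.

Lemma Cinf_Hilbert f : Cinf f -> Cinf (Hilbert f).
Proof.
  intro Hf. apply Cinf_intro.
  - intro x. rewrite !Hilbert_Series by auto. apply Series_ext; intro n. apply Cinf_hterm.
  - apply smooth_Ck. intro n. revert f Hf; induction n as [|n IH]; intros f Hf; [exact I|].
    apply (Ck_is_derive n _ (Hilbert (Derive f))); [intro; now apply is_derive_Hilbert|].
    apply IH. now apply Cinf_Derive.
Qed.

(** Not optimal, but the loss of finitely many derivatives is harmless in the
    Frechet topology. *)
Lemma Cnorm_le_Hilbert k M f : Cinf f -> Cnorm_le (k + 2) M f -> Cnorm_le k M (Hilbert f).
Proof.
  intros Hf H j x Hj. rewrite Derive_n_Hilbert by auto.
  apply Hilbert_bound; [now apply Derive_n_Cinf|].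
  intro y. change (Rabs (Derive_n f (S (S j)) y) <= M). apply H; lia.
Qed.

Lemma Series_wt_tail M a N : (forall n, Rabs (a n) <= M * wt n) ->
  Rabs (Series a - sum_n a N) <= M * / (INR N + 2).
Proof.
  intro H.
  assert (Hex : forall a, (forall n, Rabs (a n) <= M * wt n) ->
    Series a - sum_n a N = Series (fun k => a (S N + k)%nat)).
  { intros b Hb. rewrite (Series_incr_n b (S N)); [|lia|now apply ex_series_wt with M].
    rewrite <- sum_n_Reals. simpl pred. ring. }
  assert (Hw : forall n, Rabs (M * wt n) <= M * wt n).
  { intro n. right. apply Rabs_right. apply Rle_ge, Rle_trans with (2 := H n), Rabs_pos. }
  rewrite (Hex a H).
  assert (E : Series (fun k => M * wt (S N + k)) = M * / (INR N + 2)).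
  { rewrite <- (Hex (fun n => M * wt n) Hw).
    rewrite Series_scal_l, (is_series_unique _ _ is_series_wt).
    assert (Es : sum_n (fun n => M * wt n) N = M * sum_n wt N)
      by apply (sum_n_mult_l (K := R_Ring)).
    rewrite Es, sum_wt. ring. }
  rewrite <- E.
  assert (Hb : ex_series (fun k => M * wt (S N + k)))
    by (apply (ex_series_incr_n (fun n => M * wt n) (S N)); now apply ex_series_wt with M).
  apply Rle_trans with (Series (fun k => Rabs (a (S N + k)%nat))).
  - apply Series_Rabs. apply @ex_series_le with (2 := Hb).
    intro n. unfold norm; simpl; unfold abs; simpl. rewrite Rabs_Rabsolu. apply H.
  - apply Series_le; [|exact Hb]. intro n; split; [apply Rabs_pos|apply H].
Qed.

Lemma Cinf_sum_n (F : nat -> R -> R) N : (forall n, Cinf (F n)) ->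
  Cinf (fun x => sum_n (fun n => F n x) N) /\
  RInt (fun x => sum_n (fun n => F n x) N) 0 1 = sum_n (fun n => RInt (F n) 0 1) N.
Proof.
  intro H. induction N as [|N [IH1 IH2]].
  - rewrite sum_O. replace (fun x => sum_n (fun n => F n x) 0) with (F O); [auto|].
    apply functional_extensionality; intro; now rewrite sum_O.
  - replace (fun x => sum_n (fun n => F n x) (S N))
      with (fun x => sum_n (fun n => F n x) N + F (S N) x).
    + split; [now apply Cinf_plus|].
      rewrite RInt_plus_R, IH2, sum_Sn by auto using ex_RInt_Cinf. reflexivity.
    + apply functional_extensionality; intro; now rewrite sum_Sn.
Qed.

(** The remainder after [N] terms is at most [M / (N + 2)] uniformly in [x]. *)
Lemma RInt_Series (F : nat -> R -> R) M : (forall n, Cinf (F n)) ->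
  (forall n x, Rabs (F n x) <= M * wt n) -> Cinf (fun x => Series (fun n => F n x)) ->
  RInt (fun x => Series (fun n => F n x)) 0 1 = Series (fun n => RInt (F n) 0 1).
Proof.
  intros HF HM HS. symmetry. apply is_series_unique.
  set (S0 := RInt _ 0 1).
  change (is_lim_seq (sum_n (fun n => RInt (F n) 0 1)) S0).
  assert (Hl : is_lim_seq (fun N => S0 - sum_n (fun n => RInt (F n) 0 1) N) 0).
  { apply is_lim_seq_abs_0.
    apply is_lim_seq_le_le with (fun _ => 0) (fun N => M * / (INR N + 2)).
    - intro N. split; [apply Rabs_pos|].
      destruct (Cinf_sum_n F N HF) as [H1 H2]. rewrite <- H2.
      replace (S0 - _) with (RInt (fun x => Series (fun n => F n x)
        + -1 * sum_n (fun n => F n x) N) 0 1).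
      + apply RInt_unit_bound; [now apply Cinf_plus, Cinf_scal|].
        intro x. replace (_ + _) with (Series (fun n => F n x) - sum_n (fun n => F n x) N)
          by ring.
        now apply Series_wt_tail.
      + rewrite RInt_plus_R, RInt_scal_R by auto using ex_RInt_Cinf, Cinf_scal.
        unfold S0. eq_R. ring.
    - apply is_lim_seq_const.
    - replace (Finite 0) with (Rbar_mult M 0) by (simpl; f_equal; ring).
      apply is_lim_seq_scal_l, is_lim_seq_inv_shift. }
  apply is_lim_seq_ext with (fun N => S0 - (S0 - sum_n (fun n => RInt (F n) 0 1) N)).
  - intro; ring.
  - replace (Finite S0) with (Finite (S0 - 0)) by (f_equal; ring).
    apply is_lim_seq_minus'; [apply is_lim_seq_const|exact Hl].
Qed.

(** Parseval's identity for [H], obtained by integrating termwise; no Fourier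
    inversion is involved. *)
Lemma RInt_mult_Hilbert g f : Cinf f -> Cinf g ->
  RInt (fun x => g x * Hilbert f x) 0 1
  = Series (fun n => 2 * (ccoef f n * scoef g n - scoef f n * ccoef g n)).
Proof.
  intros Hf Hg.
  destruct (Cinf_bounded g Hg) as [Mg HMg].
  destruct (Cinf_bounded (Derive (Derive f))) as [M HM]; [auto using Cinf_Derive|].
  replace (fun x => g x * Hilbert f x)
    with (fun x => Series (fun n => g x * hterm f n x))
    by (apply functional_extensionality; intro;
        now rewrite Hilbert_Series, Series_scal_l by auto).
  rewrite RInt_Series with (M := Mg * M).
  - apply Series_ext; intro n.
    unfold hterm.
    transitivity (RInt (fun x => g x * (2 * ccoef f n * sinn n x
      + (- (2 * scoef f n)) * cosn n x)) 0 1).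
    + apply RInt_unit_ext; intro; ring.
    + rewrite RInt_lincomb by auto using Cinf_cosn, Cinf_sinn.
      fold (ccoef g n) (scoef g n). eq_R. ring.
  - intro n. apply Cinf_mult; [auto|apply Cinf_hterm].
  - intros n x. rewrite Rabs_mult, Rmult_assoc.
    apply Rmult_le_compat; auto using Rabs_pos, hterm_bound.
  - replace (fun x => Series (fun n => g x * hterm f n x))
      with (fun x => g x * Hilbert f x)
      by (apply functional_extensionality; intro;
          now rewrite Hilbert_Series, Series_scal_l by auto).
    apply Cinf_mult, Cinf_Hilbert; auto.
Qed.

(** The series of Parseval's identity is antisymmetric in [f] and [g]. *)
Lemma Hilbert_skew f g : Cinf f -> Cinf g ->
  RInt (fun x => g x * Hilbert f x) 0 1 = - RInt (fun x => f x * Hilbert g x) 0 1.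
Proof.
  intros Hf Hg. rewrite !RInt_mult_Hilbert by auto.
  transitivity (-1 * Series (fun n => 2 * (ccoef g n * scoef f n - scoef g n * ccoef f n))).
  - rewrite <- Series_scal_l. apply Series_ext; intro; ring.
  - eq_R; ring.
Qed.

Lemma Series_single a m : (forall n, n <> m -> a n = 0) -> Series a = a m.
Proof.
  intro H. apply is_series_unique.
  assert (Hs : forall N, sum_n a N = if le_dec m N then a m else 0).
  { induction N as [|N IH].
    - rewrite sum_O. destruct le_dec as [Hm|Hm].
      + now replace m with O by lia.
      + apply H; lia.
    - rewrite sum_Sn, IH. unfold plus; simpl.
      destruct (le_dec m N), (le_dec m (S N)); try lia.
      + rewrite (H (S N)) by lia. ring.
      + replace m with (S N) by lia. ring.
      + rewrite (H (S N)) by lia. ring. }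
  change (is_lim_seq (sum_n a) (a m)).
  apply is_lim_seq_ext_loc with (fun _ => a m); [|apply is_lim_seq_const].
  exists m. intros N HN. rewrite Hs. destruct le_dec; [reflexivity|lia].
Qed.

Lemma freq_inj n m : n <> m -> freq n * freq n <> freq m * freq m.
Proof.
  intros H E. apply H, INR_eq.
  pose proof (pos_INR n). pose proof (pos_INR m). pose proof PI_RGT_0.
  unfold freq in E.
  assert (E1 : INR n * INR n = INR m * INR m).
  { apply Rmult_eq_reg_l with (2 * PI * (2 * PI)); nra. }
  nra.
Qed.

(** Eigenfunctions of the symmetric operator [D^2] for distinct eigenvalues are
    orthogonal. *)
Lemma trig_coef_neq f n m : Cinf f ->
  Derive (Derive f) = (fun x => - (freq m * freq m) * f x) -> n <> m ->
  ccoef f n = 0 /\ scoef f n = 0.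
Proof.
  intros Hf E Hnm. pose proof (freq_inj n m Hnm) as Hne.
  assert (Hf' : Cinf (Derive f)) by now apply Cinf_Derive.
  split.
  - pose proof (ccoef_Derive _ n Hf') as H.
    rewrite E, ccoef_scal, scoef_Derive in H by auto.
    assert ((freq n * freq n - freq m * freq m) * ccoef f n = 0) as H' by lra.
    destruct (Rmult_integral _ _ H'); lra.
  - pose proof (scoef_Derive _ n Hf') as H.
    rewrite E, scoef_scal, ccoef_Derive in H by auto.
    assert ((freq n * freq n - freq m * freq m) * scoef f n = 0) as H' by lra.
    destruct (Rmult_integral _ _ H'); lra.
Qed.

Lemma Derive2_cosn m : Derive (Derive (cosn m)) = (fun x => - (freq m * freq m) * cosn m x).
Proof.
  rewrite Derive_cosn, Derive_scal_fun, Derive_sinn.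
  apply functional_extensionality; intro; ring.
Qed.

Lemma Derive2_sinn m : Derive (Derive (sinn m)) = (fun x => - (freq m * freq m) * sinn m x).
Proof.
  rewrite Derive_sinn, Derive_scal_fun, Derive_cosn.
  apply functional_extensionality; intro; ring.
Qed.

(** The relations between coefficients of [f] and [f'] force the mixed
    coefficients to vanish and the other two to coincide; their sum is the
    integral of [cos^2 + sin^2]. *)
Lemma trig_coef_eq m : (0 < m)%nat ->
  ccoef (cosn m) m = / 2 /\ scoef (cosn m) m = 0 /\
  ccoef (sinn m) m = 0 /\ scoef (sinn m) m = / 2.
Proof.
  intro Hm. pose proof (freq_pos m Hm) as Hk.
  pose proof (ccoef_Derive _ m (Cinf_cosn m)) as H1.
  pose proof (scoef_Derive _ m (Cinf_cosn m)) as H2.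
  rewrite Derive_cosn in H1, H2.
  rewrite ccoef_scal in H1 by apply Cinf_sinn.
  rewrite scoef_scal in H2 by apply Cinf_sinn.
  assert (H3 : ccoef (sinn m) m = scoef (cosn m) m).
  { apply RInt_unit_ext; intro; ring. }
  assert (H4 : ccoef (cosn m) m + scoef (sinn m) m = 1).
  { unfold ccoef, scoef.
    rewrite <- RInt_plus_R by auto using ex_RInt_Cinf, Cinf_mult, Cinf_cosn, Cinf_sinn.
    transitivity (RInt (fun _ => 1) 0 1).
    - apply RInt_unit_ext; intro x. unfold cosn, sinn.
      pose proof (sin2_cos2 (freq m * x)) as E. unfold Rsqr in E. lra.
    - rewrite RInt_const. unfold scal; simpl; unfold mult; simpl; ring. }
  assert (H5 : freq m * scoef (cosn m) m = 0) by (rewrite H3 in H1; lra).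
  assert (H6 : freq m * (ccoef (cosn m) m - scoef (sinn m) m) = 0) by lra.
  apply Rmult_integral in H5, H6. rewrite H3. repeat split; lra.
Qed.

Lemma Hilbert_trig m : (0 < m)%nat ->
  Hilbert (cosn m) = sinn m /\ Hilbert (sinn m) = (fun x => - cosn m x).
Proof.
  intro Hm. destruct (trig_coef_eq m Hm) as [E1 [E2 [E3 E4]]].
  split; apply functional_extensionality; intro x;
    rewrite Hilbert_Series by auto using Cinf_cosn, Cinf_sinn;
    rewrite (Series_single _ m).
  - unfold hterm. rewrite E1, E2. field.
  - intros n Hn. unfold hterm.
    destruct (trig_coef_neq (cosn m) n m) as [-> ->];
      auto using Cinf_cosn, Derive2_cosn. ring.
  - unfold hterm. rewrite E3, E4. field.
  - intros n Hn. unfold hterm.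
    destruct (trig_coef_neq (sinn m) n m) as [-> ->];
      auto using Cinf_sinn, Derive2_sinn. ring.
Qed.

(** By skewness, the coefficients of [H f] are the integrals of [f] against the
    transforms of the trigonometric functions. *)
Lemma coef_Hilbert f n : Cinf f -> (0 < n)%nat ->
  ccoef (Hilbert f) n = - scoef f n /\ scoef (Hilbert f) n = ccoef f n.
Proof.
  intros Hf Hn. destruct (Hilbert_trig n Hn) as [E1 E2]. split.
  - pose proof (Hilbert_skew f (cosn n) Hf (Cinf_cosn n)) as H. rewrite E1 in H.
    etransitivity; [|exact H]. apply RInt_unit_ext; intro; ring.
  - pose proof (Hilbert_skew f (sinn n) Hf (Cinf_sinn n)) as H. rewrite E2 in H.
    etransitivity; [|etransitivity; [exact H|]].
    + apply RInt_unit_ext; intro; ring.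
    + transitivity (- RInt (fun x => (-1) * (f x * cosn n x)) 0 1).
      * f_equal. apply RInt_unit_ext; intro; ring.
      * rewrite RInt_scal_R by auto using ex_RInt_Cinf, Cinf_mult, Cinf_cosn.
        unfold ccoef. eq_R. ring.
Qed.

Lemma Hilbert_const c x : Hilbert (fun _ => c) x = 0.
Proof.
  apply Rabs_eq_0. apply Rle_antisym; [|apply Rabs_pos].
  apply Hilbert_bound; [apply Cinf_const|]. intro y.
  replace (Derive (Derive (fun _ => c)) y) with 0; [rewrite Rabs_R0; lra|].
  replace (Derive (fun _ : R => c)) with (fun _ : R => 0).
  - now rewrite Derive_const.
  - apply functional_extensionality; intro; now rewrite Derive_const.
Qed.

Lemma RInt_const_R (c : R) : RInt (fun _ : R => c) 0 1 = c.
Proof. rewrite RInt_const. unfold scal; simpl; unfold mult; simpl; ring. Qed.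

Lemma RInt_Hilbert f : Cinf f ->
  RInt (Hilbert f) 0 1 = 0.
Proof.
  intro Hf. pose proof (Hilbert_skew f (fun _ => 1) Hf (Cinf_const 1)) as H.
  cbv beta in H.
  replace (fun x => 1 * Hilbert f x) with (Hilbert f) in H
    by (apply functional_extensionality; intro; ring).
  rewrite H. transitivity (- RInt (fun _ : R => 0) 0 1).
  - f_equal. apply RInt_unit_ext; intro. rewrite Hilbert_const; ring.
  - rewrite RInt_const_R; eq_R; ring.
Qed.

(** By [coef_Hilbert], all coefficients of [f + H H f] vanish, those of index 0
    because both terms have mean zero. *)
Lemma Hilbert_Hilbert (f : R -> R) x : Cinf f -> RInt f 0 1 = 0 -> Hilbert (Hilbert f) x = - f x.
Proof.
  intros Hf H0.
  enough (H : f x + Hilbert (Hilbert f) x = 0) by lra.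
  apply (fourier_null_eq_0 (fun x => f x + Hilbert (Hilbert f) x)).
  pose proof (Cinf_Hilbert f Hf) as H1. pose proof (Cinf_Hilbert _ H1) as H2.
  split; [now apply Cinf_plus|]. intros [|n].
  - rewrite !scoef_0. split; [|reflexivity].
    rewrite ccoef_plus by auto.
    assert (E : forall g : R -> R, ccoef g 0 = RInt g 0 1).
    { intro g. apply RInt_unit_ext; intro; rewrite cosn_0; ring. }
    rewrite !E, H0, RInt_Hilbert by auto. ring.
  - rewrite ccoef_plus, scoef_plus by auto.
    destruct (coef_Hilbert f (S n) Hf) as [E1 E2]; [lia|].
    destruct (coef_Hilbert (Hilbert f) (S n) H1) as [E3 E4]; [lia|].
    rewrite E3, E4, E1, E2. lra.
Qed.

(** * The operator [Lambda] and its inverse *)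

(** Everything about [H] is used through the lemmas above; unification must
    not unfold it to its Fourier series. *)
Opaque Hilbert.

Lemma Cinf_Lambda u : Cinf u -> Cinf (Lambda u).
Proof. intro. unfold Lambda. now apply Cinf_Hilbert, Cinf_Derive. Qed.

Lemma Derive_Lambda u : Cinf u -> Derive (Lambda u) = Lambda (Derive u).
Proof. intro. unfold Lambda. now apply Derive_Hilbert, Cinf_Derive. Qed.

Lemma Lambda_plus f g : Cinf f -> Cinf g ->
  Lambda (fun x => f x + g x) = (fun x => Lambda f x + Lambda g x).
Proof.
  intros. unfold Lambda. rewrite Derive_plus_Cinf by auto.
  apply Hilbert_plus; auto using Cinf_Derive.
Qed.

Lemma Lambda_scal c f : Cinf f -> Lambda (fun x => c * f x) = (fun x => c * Lambda f x).
Proof.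
  intros. unfold Lambda. rewrite Derive_scal_fun. apply Hilbert_scal; auto using Cinf_Derive.
Qed.

Lemma Cnorm_le_Lambda k M u : Cinf u -> Cnorm_le (k + 3) M u -> Cnorm_le k M (Lambda u).
Proof.
  intros Hu H. unfold Lambda. apply Cnorm_le_Hilbert; [now apply Cinf_Derive|].
  apply Cnorm_le_Derive. now replace (S (k + 2)) with (k + 3)%nat by lia.
Qed.

(** The [H^(1/2)] inner product of two fields in Eulerian form. *)
Definition pairing (f g : R -> R) : R := RInt (fun x => f x * Lambda g x) 0 1.

(** Both [H] and [D] are skew-symmetric, and they commute. *)
Lemma pairing_sym f g : Cinf f -> Cinf g -> pairing f g = pairing g f.
Proof.
  intros Hf Hg. unfold pairing, Lambda at 1.
  rewrite Hilbert_skew by auto using Cinf_Derive.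
  rewrite RInt_by_parts, Derive_Hilbert by auto using Cinf_Hilbert.
  unfold Lambda. eq_R; ring.
Qed.

Lemma pairing_plus_l f g h : Cinf f -> Cinf g -> Cinf h ->
  pairing (fun x => f x + g x) h = pairing f h + pairing g h.
Proof.
  intros. unfold pairing.
  rewrite <- RInt_plus_R by auto using ex_RInt_Cinf, Cinf_mult, Cinf_Lambda.
  apply RInt_unit_ext; intro; ring.
Qed.

Lemma pairing_scal_l c f h : Cinf f -> Cinf h ->
  pairing (fun x => c * f x) h = c * pairing f h.
Proof.
  intros. unfold pairing.
  rewrite <- RInt_scal_R by auto using ex_RInt_Cinf, Cinf_mult, Cinf_Lambda.
  apply RInt_unit_ext; intro; ring.
Qed.

Lemma pairing_plus_r f g h : Cinf f -> Cinf g -> Cinf h ->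
  pairing h (fun x => f x + g x) = pairing h f + pairing h g.
Proof.
  intros. unfold pairing. rewrite Lambda_plus by assumption.
  rewrite <- RInt_plus_R by auto using ex_RInt_Cinf, Cinf_mult, Cinf_Lambda.
  apply RInt_unit_ext; intro; ring.
Qed.

Lemma pairing_scal_r c f h : Cinf f -> Cinf h ->
  pairing h (fun x => c * f x) = c * pairing h f.
Proof.
  intros. unfold pairing. rewrite Lambda_scal by assumption.
  rewrite <- RInt_scal_R by auto using ex_RInt_Cinf, Cinf_mult, Cinf_Lambda.
  apply RInt_unit_ext; intro; ring.
Qed.

Lemma pairing_bound M N f g : Cinf f -> Cinf g -> Cnorm_le 0 M f -> Cnorm_le 3 N g ->
  Rabs (pairing f g) <= M * N.
Proof.
  intros Hf Hg HM HN.
  apply RInt_unit_bound; [apply Cinf_mult; auto using Cinf_Lambda|].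
  intro x. rewrite Rabs_mult.
  apply Rmult_le_compat; auto using Rabs_pos.
  - rewrite Cnorm_le_0 in HM. apply HM.
  - pose proof (Cnorm_le_Lambda 0 N g Hg HN) as HL. rewrite Cnorm_le_0 in HL. apply HL.
Qed.

(** From [Lambda v = m] follows [v' = - H m], since [v'] has mean zero. *)
Definition Lambda_inv (m : R -> R) (x : R) : R := - RInt (Hilbert m) 0 x.

Lemma is_derive_Lambda_inv m x : Cinf m -> is_derive (Lambda_inv m) x (- Hilbert m x).
Proof.
  intro Hm. apply (is_derive_opp (fun x => RInt (Hilbert m) 0 x)).
  apply (is_derive_RInt (V := R_NormedModule) (Hilbert m) _ 0).
  - exists (mkposreal 1 Rlt_0_1). intros y _.
    apply (RInt_correct (V := R_CompleteNormedModule)).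
    now apply ex_RInt_Cinf, Cinf_Hilbert.
  - apply smooth_continuous, Cinf_smooth, Cinf_Hilbert, Hm.
Qed.

Lemma Derive_Lambda_inv m : Cinf m -> Derive (Lambda_inv m) = (fun x => - Hilbert m x).
Proof. intro; apply is_derive_Derive; intro; now apply is_derive_Lambda_inv. Qed.

Lemma Lambda_inv_0 m : Lambda_inv m 0 = 0.
Proof.
  unfold Lambda_inv. rewrite RInt_point. unfold zero; simpl; ring.
Qed.

Lemma null_derivative_eq (f : R -> R) x y : (forall z, is_derive f z 0) -> f x = f y.
Proof.
  intro H. destruct (MVT_gen f x y (fun _ => 0)) as [c [_ E]]; [auto| |lra].
  intros z _. apply continuity_pt_filterlim.
  apply (ex_derive_continuous (V := R_NormedModule) f). eexists; apply H.
Qed.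

(** Periodicity holds because [H m] has mean zero. *)
Lemma C0inf_Lambda_inv m : Cinf m -> C0inf (Lambda_inv m).
Proof.
  intro Hm. split; [|apply Lambda_inv_0].
  pose proof (Cinf_Hilbert m Hm) as HH.
  apply Cinf_intro.
  - intro x.
    enough (E : Lambda_inv m (x + 1) - Lambda_inv m x
                = Lambda_inv m (0 + 1) - Lambda_inv m 0).
    { rewrite Lambda_inv_0, Rplus_0_l in E. unfold Lambda_inv at 3 in E.
      rewrite (RInt_Hilbert m Hm) in E. lra. }
    apply (null_derivative_eq (fun x => Lambda_inv m (x + 1) - Lambda_inv m x)).
    intro z. evar_last.
    + apply @is_derive_minus; [|now apply is_derive_Lambda_inv].
      apply (is_derive_comp (V := R_NormedModule) (Lambda_inv m) (fun y => y + 1)).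
      * now apply is_derive_Lambda_inv.
      * auto_derive; [exact I|reflexivity].
    + rewrite (proj1 HH). unfold minus, plus, opp, scal; simpl. unfold mult; simpl. ring.
  - apply (smooth_is_derive _ _ (fun x => is_derive_Lambda_inv m x Hm)).
    apply Cinf_smooth, Cinf_opp, HH.
Qed.

Lemma Lambda_Lambda_inv m : Cinf m -> RInt m 0 1 = 0 -> Lambda (Lambda_inv m) = m.
Proof.
  intros Hm H0. apply functional_extensionality; intro x.
  unfold Lambda. rewrite Derive_Lambda_inv by auto.
  replace (fun x => - Hilbert m x) with (fun x => -1 * Hilbert m x)
    by (apply functional_extensionality; intro; ring).
  rewrite Hilbert_scal by auto using Cinf_Hilbert.
  rewrite Hilbert_Hilbert by auto. ring.
Qed.

(** If [H v' = 0] then [v' = - H H v' = 0]. *)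
Lemma Lambda_inj v x : C0inf v -> (forall y, Lambda v y = 0) -> v x = 0.
Proof.
  intros [Hv H0] H. rewrite <- H0. apply null_derivative_eq. intro z.
  replace 0 with (Derive v z); [now apply Derive_correct, Cinf_ex_derive|].
  pose proof (Hilbert_Hilbert (Derive v) z (Cinf_Derive v Hv) (RInt_Derive_Cinf v Hv)) as E.
  replace (Hilbert (Derive v)) with (fun _ : R => 0) in E.
  - rewrite Hilbert_const in E. lra.
  - apply functional_extensionality; intro y. unfold Lambda in H. now rewrite H.
Qed.

Lemma Lambda_inv_plus f g : Cinf f -> Cinf g ->
  Lambda_inv (fun x => f x + g x) = (fun x => Lambda_inv f x + Lambda_inv g x).
Proof.
  intros. apply functional_extensionality; intro x. unfold Lambda_inv.
  rewrite Hilbert_plus, RInt_plus_R by auto using ex_RInt_Cinf, Cinf_Hilbert.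
  eq_R; ring.
Qed.

Lemma Lambda_inv_scal c f : Cinf f ->
  Lambda_inv (fun x => c * f x) = (fun x => c * Lambda_inv f x).
Proof.
  intros. apply functional_extensionality; intro x. unfold Lambda_inv.
  rewrite Hilbert_scal, RInt_scal_R by auto using ex_RInt_Cinf, Cinf_Hilbert.
  eq_R; ring.
Qed.

Lemma Cnorm_le_Lambda_inv k M m : Cinf m -> Cnorm_le (k + 2) M m -> Cnorm_le k M (Lambda_inv m).
Proof.
  intros Hm H.
  pose proof (Cnorm_le_Hilbert k M m Hm H) as HH.
  assert (H0 : forall x, Rabs (Lambda_inv m x) <= M).
  { intro x. destruct (periodic_reduce (Lambda_inv m) x) as [y [Hy <-]];
      [apply C0inf_Lambda_inv, Hm|].
    unfold Lambda_inv. rewrite Rabs_Ropp.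
    apply Rle_trans with ((y - 0) * M).
    - apply abs_RInt_le_const; [lra|now apply ex_RInt_Cinf, Cinf_Hilbert|].
      intros t _. apply (HH O); lia.
    - pose proof (Cnorm_le_pos _ _ _ H). nra. }
  destruct k as [|k]; [now apply Cnorm_le_0|].
  apply Cnorm_le_S. split; [exact H0|].
  rewrite Derive_Lambda_inv by auto. apply Cnorm_le_opp.
  eapply Cnorm_le_le; [| |exact HH]; [lia|lra].
Qed.

(** * The connection associated with the equation *)

(** The symmetric bilinear form associated with the quadratic expression
    [u w_x + a u_x w], [w = Lambda u]. *)
Definition polarized_transport (a : R) (u v : R -> R) (x : R) : R :=
  / 2 * ((u x * Lambda (Derive v) x + v x * Lambda (Derive u) x)
         + a * (Derive u x * Lambda v x + Derive v x * Lambda u x)).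

(** The operator [B] of the connection. *)
Definition christoffel (a : R) (u v : R -> R) : R -> R := Lambda_inv (polarized_transport a u v).

Lemma Cinf_polarized a u v : Cinf u -> Cinf v -> Cinf (polarized_transport a u v).
Proof.
  intros. apply Cinf_scal.
  apply (Cinf_plus (fun x => u x * Lambda (Derive v) x + v x * Lambda (Derive u) x)).
  - apply Cinf_plus; auto using Cinf_mult, Cinf_Derive, Cinf_Lambda.
  - apply Cinf_scal, Cinf_plus; auto using Cinf_mult, Cinf_Derive, Cinf_Lambda.
Qed.

Lemma polarized_sym a u v : polarized_transport a u v = polarized_transport a v u.
Proof. apply functional_extensionality; intro x. unfold polarized_transport; ring. Qed.

Lemma polarized_plus a u v w : Cinf u -> Cinf v ->
  polarized_transport a (fun y => u y + v y) w
  = (fun x => polarized_transport a u w x + polarized_transport a v w x).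
Proof.
  intros. apply functional_extensionality; intro x. unfold polarized_transport.
  rewrite Derive_plus_Cinf, !Lambda_plus by auto using Cinf_Derive. ring.
Qed.

Lemma polarized_scal a c u v : Cinf u ->
  polarized_transport a (fun y => c * u y) v = (fun x => c * polarized_transport a u v x).
Proof.
  intros. apply functional_extensionality; intro x. unfold polarized_transport.
  rewrite Derive_scal_fun, !Lambda_scal by auto using Cinf_Derive. ring.
Qed.

(** Integrating the first two products by parts leaves a multiple of
    [int (u' H v' + v' H u')]. *)
Lemma RInt_polarized a u v : Cinf u -> Cinf v -> RInt (polarized_transport a u v) 0 1 = 0.
Proof.
  intros Hu Hv.
  assert (Hu' : Cinf (Derive u)) by now apply Cinf_Derive.
  assert (Hv' : Cinf (Derive v)) by now apply Cinf_Derive.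
  unfold polarized_transport.
  rewrite RInt_scal_R, RInt_plus_R, RInt_plus_R, RInt_scal_R, RInt_plus_R
    by auto 7 using ex_RInt_Cinf, Cinf_scal, Cinf_plus, Cinf_mult, Cinf_Lambda.
  pose proof (RInt_by_parts _ _ Hu (Cinf_Lambda v Hv)) as E1.
  pose proof (RInt_by_parts _ _ Hv (Cinf_Lambda u Hu)) as E2.
  rewrite Derive_Lambda in E1, E2 by auto.
  assert (E3 : RInt (fun x => Derive v x * Lambda u x) 0 1
               = - RInt (fun x => Derive u x * Lambda v x) 0 1).
  { unfold Lambda. now apply Hilbert_skew. }
  rewrite E1, E2 in E3. rewrite E1, E2.
  assert (E4 : RInt (fun x => v x * Lambda (Derive u) x) 0 1
               = - RInt (fun x => u x * Lambda (Derive v) x) 0 1) by lra.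
  rewrite E4. eq_R. ring.
Qed.

Lemma C0inf_christoffel a u v : Cinf u -> Cinf v -> C0inf (christoffel a u v).
Proof. intros. unfold christoffel. now apply C0inf_Lambda_inv, Cinf_polarized. Qed.

Lemma Lambda_christoffel a u v : Cinf u -> Cinf v ->
  Lambda (christoffel a u v) = polarized_transport a u v.
Proof.
  intros. unfold christoffel.
  apply Lambda_Lambda_inv; [now apply Cinf_polarized|now apply RInt_polarized].
Qed.

Lemma christoffel_sym a u v : christoffel a u v = christoffel a v u.
Proof. unfold christoffel. now rewrite polarized_sym. Qed.

Lemma christoffel_plus a u v w : Cinf u -> Cinf v -> Cinf w ->
  christoffel a (fun y => u y + v y) w
  = (fun x => christoffel a u w x + christoffel a v w x).
Proof.
  intros. unfold christoffel. rewrite polarized_plus by auto.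
  apply Lambda_inv_plus; now apply Cinf_polarized.
Qed.

Lemma christoffel_scal a c u v : Cinf u -> Cinf v ->
  christoffel a (fun y => c * u y) v = (fun x => c * christoffel a u v x).
Proof.
  intros. unfold christoffel. rewrite polarized_scal by auto.
  apply Lambda_inv_scal; now apply Cinf_polarized.
Qed.

Lemma Cnorm_le_polarized a k M N u v : Cinf u -> Cinf v ->
  Cnorm_le (k + 4) M u -> Cnorm_le (k + 4) N v ->
  Cnorm_le k ((1 + Rabs a) * 2 ^ k * M * N) (polarized_transport a u v).
Proof.
  intros Hu Hv HM HN.
  assert (Hu' : Cinf (Derive u)) by now apply Cinf_Derive.
  assert (Hv' : Cinf (Derive v)) by now apply Cinf_Derive.
  assert (HL : forall P f, Cinf f -> Cnorm_le (k + 4) P f ->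
    Cnorm_le k P f /\ Cnorm_le k P (Derive f) /\
    Cnorm_le k P (Lambda f) /\ Cnorm_le k P (Lambda (Derive f))).
  { intros P f Hf HP. repeat split.
    - apply (Cnorm_le_le (k + 4) k P P); [lia|lra|auto].
    - apply Cnorm_le_Derive, (Cnorm_le_le (k + 4) (S k) P P); [lia|lra|auto].
    - apply Cnorm_le_Lambda; [auto|]. apply (Cnorm_le_le (k + 4) (k + 3) P P); [lia|lra|auto].
    - apply Cnorm_le_Lambda; [now apply Cinf_Derive|].
      apply Cnorm_le_Derive, (Cnorm_le_le (k + 4) (S (k + 3)) P P); [lia|lra|auto]. }
  destruct (HL M u Hu HM) as [U1 [U2 [U3 U4]]].
  destruct (HL N v Hv HN) as [V1 [V2 [V3 V4]]].
  unfold polarized_transport.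
  replace ((1 + Rabs a) * 2 ^ k * M * N) with
    (Rabs (/ 2) * ((2 ^ k * M * N + 2 ^ k * N * M)
                   + Rabs a * (2 ^ k * M * N + 2 ^ k * N * M)))
    by (rewrite (Rabs_right (/ 2)) by lra; field).
  apply Cnorm_le_scal.
  apply (Cnorm_le_plus k (2 ^ k * M * N + 2 ^ k * N * M)
    (Rabs a * (2 ^ k * M * N + 2 ^ k * N * M))
    (fun x => u x * Lambda (Derive v) x + v x * Lambda (Derive u) x)
    (fun x => a * (Derive u x * Lambda v x + Derive v x * Lambda u x)));
    auto 7 using Cinf_scal, Cinf_plus, Cinf_mult, Cinf_Lambda, Cnorm_le_mult.
  - apply Cnorm_le_plus; auto 7 using Cinf_scal, Cinf_plus, Cinf_mult, Cinf_Lambda, Cnorm_le_mult.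
  - apply Cnorm_le_scal, Cnorm_le_plus;
      auto 7 using Cinf_scal, Cinf_plus, Cinf_mult, Cinf_Lambda, Cnorm_le_mult.
Qed.

Lemma Cnorm_le_christoffel a k M N u v : Cinf u -> Cinf v ->
  Cnorm_le (k + 6) M u -> Cnorm_le (k + 6) N v ->
  Cnorm_le k ((1 + Rabs a) * 2 ^ (k + 2) * M * N) (christoffel a u v).
Proof.
  intros Hu Hv HM HN. unfold christoffel. apply Cnorm_le_Lambda_inv; [now apply Cinf_polarized|].
  apply Cnorm_le_polarized; auto; now replace (k + 2 + 4)%nat with (k + 6)%nat by lia.
Qed.

(** A bilinear map bounded by [C^K] norms is continuous:
    [B(u',v') - B(u,v) = B(u' - u, v') + B(v' - v, u)]. *)
Lemma christoffel_continuous a u v : C0inf u -> C0inf v ->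
  filterlim (fun p => christoffel a (fst p) (snd p))
    (filter_prod (within C0inf (Cinf_locally u)) (within C0inf (Cinf_locally v)))
    (Cinf_locally (christoffel a u v)).
Proof.
  intros [Hu _] [Hv _] P [k [eps HP]].
  destruct (Cinf_Cnorm_le u (k + 6) Hu) as [M HM]. destruct (Cinf_Cnorm_le v (k + 6) Hv) as [N HN].
  pose proof (Cnorm_le_pos _ _ _ HM). pose proof (Cnorm_le_pos _ _ _ HN).
  set (K := (1 + Rabs a) * 2 ^ (k + 2)).
  assert (HK : 0 <= K).
  { pose proof (Rabs_pos a). apply Rmult_le_pos; [lra|]. apply pow_le; lra. }
  (* With [d <= 1], the two terms add up to at most [K d (M + N + 1)]. *)
  set (d := Rmin 1 (eps / (K * (M + N + 1) + 1))).
  assert (Hden : 0 < K * (M + N + 1) + 1) by nra.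
  assert (Hd : 0 < d).
  { apply Rmin_glb_lt; [lra|]. apply Rdiv_lt_0_compat; [apply cond_pos|auto]. }
  set (Q := fun f g => Cinf g /\ Cnorm_le (k + 6) d (fun x => g x - f x)).
  assert (HQ : forall f, Cinf f -> within C0inf (Cinf_locally f) (Q f)).
  { intros f Hf. exists (k + 6)%nat, (mkposreal d Hd). intros g Hg Hgf [_ _].
    split; [exact Hg|]. intros j x Hj. rewrite Derive_n_minus_Cinf by auto.
    left. now apply (Hgf j x). }
  exists (Q u) (Q v); [now apply HQ|now apply HQ|].
  intros u' v' [Hu' Nu] [Hv' Nv]. simpl. apply HP.
  { now apply C0inf_christoffel. }
  intros j x Hj.
  assert (Du : Cinf (fun x => u' x - u x)) by now apply Cinf_minus.
  assert (Dv : Cinf (fun x => v' x - v x)) by now apply Cinf_minus.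
  assert (Nv' : Cnorm_le (k + 6) (N + d) v').
  { replace v' with (fun x => v x + (v' x - v x))
      by (apply functional_extensionality; intro; ring).
    now apply Cnorm_le_plus. }
  assert (E : (fun x => christoffel a u' v' x - christoffel a u v x)
    = (fun x => christoffel a (fun x => u' x - u x) v' x
                + christoffel a (fun x => v' x - v x) u x)).
  { assert (E1 : christoffel a u' v'
      = (fun x => christoffel a u v' x + christoffel a (fun x => u' x - u x) v' x)).
    { rewrite <- christoffel_plus by auto. f_equal.
      apply functional_extensionality; intro; ring. }
    assert (E2 : christoffel a u v'
      = (fun x => christoffel a v u x + christoffel a (fun x => v' x - v x) u x)).
    { rewrite (christoffel_sym a u v'), <- christoffel_plus by auto. f_equal.
      apply functional_extensionality; intro; ring. }
    apply functional_extensionality; intro y.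
    rewrite E1, E2, (christoffel_sym a v u). ring. }
  assert (Hn : Cnorm_le k (K * d * (N + d) + K * d * M)
    (fun x => christoffel a u' v' x - christoffel a u v x)).
  { rewrite E.
    apply Cnorm_le_plus; try (apply C0inf_christoffel; auto); now apply Cnorm_le_christoffel. }
  specialize (Hn j x Hj).
  rewrite Derive_n_minus_Cinf in Hn by now apply C0inf_christoffel.
  apply Rle_lt_trans with (1 := Hn).
  assert (d <= 1) by apply Rmin_l.
  assert (Hde : d * (K * (M + N + 1) + 1) <= eps).
  { replace (pos eps) with (eps / (K * (M + N + 1) + 1) * (K * (M + N + 1) + 1))
      by (field; lra).
    apply Rmult_le_compat_r; [lra|apply Rmin_r]. }
  assert (K * d * (N + d) <= K * d * (N + 1)).
  { apply Rmult_le_compat_l; [nra|lra]. }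
  nra.
Qed.

Definition mCLM_connection (a : R) : ri_sym_connection.
Proof.
  refine {| conn_op := christoffel a |}.
  - intros u v [Hu _] [Hv _]. now apply C0inf_christoffel.
  - intros u v _ _ x. now rewrite christoffel_sym.
  - intros u v w [Hu _] [Hv _] [Hw _] x. now rewrite christoffel_plus.
  - intros l u v [Hu _] [Hv _] x. now rewrite christoffel_scal.
  - intros u v Hu Hv. now apply christoffel_continuous.
Defined.

(** Both sides of the equation [u_t = - B(u,u)] lie in the space on which
    [Lambda] is injective, so it may be tested after applying [Lambda]. *)
Lemma geodesic_equation a u ut : C0inf u -> C0inf ut ->
  (forall x, ut x + christoffel a u u x = 0) <->
  (forall x, Lambda ut x + u x * Lambda (Derive u) x + a * Derive u x * Lambda u x = 0).
Proof.
  intros [Hu _] [Hut Hut0].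
  destruct (C0inf_christoffel a u u Hu Hu) as [HB HB0].
  set (g := fun x => ut x + christoffel a u u x).
  assert (E : forall x, Lambda ut x + u x * Lambda (Derive u) x + a * Derive u x * Lambda u x
    = Lambda g x).
  { intro x. unfold g. rewrite Lambda_plus, Lambda_christoffel by auto.
    unfold polarized_transport. field. }
  split; intros H x.
  - rewrite E. replace g with (fun _ : R => 0)
      by (apply functional_extensionality; intro; symmetry; apply H).
    unfold Lambda. replace (Derive (fun _ : R => 0)) with (fun _ : R => 0).
    + apply Hilbert_const.
    + apply functional_extensionality; intro; now rewrite Derive_const.
  - apply (Lambda_inj g x).
    + split; [now apply Cinf_plus|]. unfold g. rewrite Hut0, HB0. ring.
    + intro y. now rewrite <- E.
Qed.

(** The part of the covariant derivative of [w] along a curve of velocity [u]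
    that contains no time derivative. *)
Definition cov_term (a : R) (u w : R -> R) (x : R) : R :=
  / 2 * (u x * Derive w x - Derive u x * w x) + christoffel a u w x.

Lemma Cinf_cov_term a u w : Cinf u -> Cinf w -> Cinf (cov_term a u w).
Proof.
  intros. apply Cinf_plus; [|now apply C0inf_christoffel].
  apply Cinf_scal, Cinf_minus; auto using Cinf_mult, Cinf_Derive.
Qed.

Lemma pairing_cov_term u w z : Cinf u -> Cinf w -> Cinf z ->
  pairing (cov_term 2 u w) z
  = RInt (fun x => / 2 * (u x * Derive w x - Derive u x * w x) * Lambda z x
                   + z x * polarized_transport 2 u w x) 0 1.
Proof.
  intros Hu Hw Hz. unfold cov_term.
  pose proof (C0inf_christoffel 2 u w Hu Hw) as [HB _].
  assert (Ha : Cinf (fun x => / 2 * (u x * Derive w x - Derive u x * w x)))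
    by (apply Cinf_scal, Cinf_minus; auto using Cinf_mult, Cinf_Derive).
  rewrite pairing_plus_l, (pairing_sym (christoffel 2 u w)) by auto.
  unfold pairing. rewrite Lambda_christoffel by auto.
  rewrite RInt_plus_R by auto using ex_RInt_Cinf, Cinf_mult, Cinf_polarized, Cinf_Lambda.
  reflexivity.
Qed.

(** Moving [Lambda] onto [B] by symmetry turns the left-hand side into a cubic
    expression in [u], [w], [z] and their transforms, which for
    [a = 2] is an exact derivative. *)
Lemma metric_defect u w z : Cinf u -> Cinf w -> Cinf z ->
  pairing (cov_term 2 u w) z + pairing w (cov_term 2 u z) = 0.
Proof.
  intros Hu Hw Hz.
  rewrite (pairing_sym w) by auto using Cinf_cov_term.
  rewrite !pairing_cov_term by auto.
  assert (Hi : forall w z, Cinf w -> Cinf z ->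
    Cinf (fun x => / 2 * (u x * Derive w x - Derive u x * w x) * Lambda z x
                   + z x * polarized_transport 2 u w x)).
  { intros f g Hf Hg. apply Cinf_plus; [|auto using Cinf_mult, Cinf_polarized].
    apply Cinf_mult; [|now apply Cinf_Lambda].
    apply Cinf_scal, Cinf_minus; auto using Cinf_mult, Cinf_Derive. }
  rewrite <- RInt_plus_R by auto using ex_RInt_Cinf.
  (* A primitive of the integrand. *)
  set (p := fun x => / 2 * (w x * u x * Lambda z x) + / 2 * (z x * u x * Lambda w x)
                     + w x * z x * Lambda u x).
  assert (Hp : Cinf p).
  { unfold p. repeat apply Cinf_plus; try apply Cinf_scal;
      auto using Cinf_mult, Cinf_Lambda. }
  etransitivity; [|exact (RInt_Derive_Cinf p Hp)]. apply RInt_unit_ext; intro x.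
  unfold p.
  pose proof (Cinf_Lambda u Hu). pose proof (Cinf_Lambda w Hw).
  pose proof (Cinf_Lambda z Hz).
  repeat (rewrite ?Derive_plus_Cinf, ?Derive_scal_fun, ?Derive_mult_Cinf
    by auto 6 using Cinf_plus, Cinf_scal, Cinf_mult).
  rewrite !Derive_Lambda by auto. unfold polarized_transport. field.
Qed.

(** * Jointly smooth functions of time and space *)

Definition dx (F : R -> R -> R) (t x : R) : R := Derive (F t) x.

(** Partial derivatives up to order [n], taken in any sequence, exist and are
    jointly continuous for times in [I].  Having [dt F] and [dx F] in the class
    of order [n - 1] makes every closure property an induction on [n]. *)
Fixpoint joint_Ck (I : R -> Prop) (n : nat) (F : R -> R -> R) : Prop :=
  (forall t x, I t -> continuity_2d_pt F t x) /\
  match n with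
  | O => True
  | S m => (forall t x, I t -> ex_derive (fun s => F s x) t /\ ex_derive (F t) x)
           /\ joint_Ck I m (dt F) /\ joint_Ck I m (dx F)
  end.

Lemma joint_Ck_continuous I n F t x : joint_Ck I n F -> I t -> continuity_2d_pt F t x.
Proof. destruct n; intros [H _]; apply H. Qed.

Lemma joint_Ck_S I n F : joint_Ck I (S n) F -> joint_Ck I n F.
Proof.
  revert F; induction n as [|n IH]; intros F [H0 [H1 [H2 H3]]].
  - split; [exact H0|exact Logic.I].
  - split; [exact H0|]. split; [exact H1|]. split; now apply IH.
Qed.

Lemma open_locally_2d (I : R -> Prop) (P : R -> R -> Prop) t x : open I -> I t ->
  (forall s y, I s -> P s y) -> locally_2d P t x.
Proof.
  intros HI Ht H. destruct (HI t Ht) as [e He]. exists e.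
  intros s y Hs _. apply H, He, Hs.
Qed.

Lemma open_locally (I : R -> Prop) (P : R -> Prop) t : open I -> I t ->
  (forall s, I s -> P s) -> locally t P.
Proof. intros HI Ht H. apply filter_imp with (2 := HI t Ht), H. Qed.

Lemma joint_Ck_ext I n F G : open I -> (forall t x, I t -> F t x = G t x) ->
  joint_Ck I n F -> joint_Ck I n G.
Proof.
  intro HI. revert F G; induction n as [|n IH]; intros F G E HF;
    (split; [intros t x Ht; apply continuity_2d_pt_ext_loc with F;
             [now apply (open_locally_2d I)|now apply (joint_Ck_continuous _ _ _ _ _ HF)]|]).
  - exact Logic.I.
  - destruct HF as [H0 [H1 [H2 H3]]].
    assert (El : forall t x, I t -> locally t (fun s => F s x = G s x))
      by (intros; apply (open_locally I); auto).
    split; [|split].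
    + intros t x Ht. destruct (H1 t x Ht) as [D1 D2]. split.
      * apply ex_derive_ext_loc with (fun s => F s x); auto.
      * apply ex_derive_ext with (F t); auto.
    + apply IH with (2 := H2). intros t x Ht. apply Derive_ext_loc; auto.
    + apply IH with (2 := H3). intros t x Ht. apply Derive_ext; auto.
Qed.

Lemma continuity_2d_pt_slice (F : R -> R -> R) t x :
  continuity_2d_pt F t x -> continuous (F t) x.
Proof.
  intros H P [e He]. destruct (H e) as [d Hd]. exists d. intros y Hy. apply He.
  apply Hd; [|exact Hy]. rewrite Rminus_diag, Rabs_R0. apply cond_pos.
Qed.

(** Total differentiability, needed for the chain rule, follows from the
    continuity of one of the two partial derivatives. *)
Lemma C1_differentiable (I : R -> Prop) F Ft Fx t x : open I -> I t ->
  (forall t x, I t -> is_derive (fun s => F s x) t (Ft t x)) ->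
  is_derive (F t) x (Fx t x) -> continuity_2d_pt Ft t x ->
  differentiable_pt_lim F t x (Ft t x) (Fx t x).
Proof.
  intros HI Ht H1 H2 Hc. apply filterdiff_differentiable_pt_lim.
  apply (is_derive_filterdiff F t x Ft (Fx t x)).
  - destruct (HI t Ht) as [e He]. exists e. intros [s y] [Hs Hy].
    apply H1, He, Hs.
  - exact H2.
  - now apply continuity_2d_pt_filterlim in Hc.
Qed.

(** Regularity may be checked on any functions that happen to be the partial
    derivatives for times in [I]. *)
Lemma joint_Ck_intro I n F Ft Fx : open I ->
  (forall t x, I t -> is_derive (fun s => F s x) t (Ft t x) /\ is_derive (F t) x (Fx t x)) ->
  joint_Ck I n Ft -> joint_Ck I n Fx -> joint_Ck I (S n) F.
Proof.
  intros HI H Ht Hx. split; [|split; [|split]].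
  - intros t x It. apply differentiable_continuity_pt. exists (Ft t x), (Fx t x).
    apply (C1_differentiable I); auto; [intros; now apply H|now apply H|].
    now apply (joint_Ck_continuous I n).
  - intros t x It. destruct (H t x It). split; eexists; eauto.
  - apply joint_Ck_ext with Ft; auto. intros t x It. symmetry. now apply is_derive_unique, H.
  - apply joint_Ck_ext with Fx; auto. intros t x It. symmetry. now apply is_derive_unique, H.
Qed.

Lemma joint_Ck_is_derive I n F t x : joint_Ck I (S n) F -> I t ->
  is_derive (fun s => F s x) t (dt F t x) /\ is_derive (F t) x (dx F t x).
Proof.
  intros [_ [H _]] It. destruct (H t x It). split; now apply Derive_correct.
Qed.

Lemma joint_Ck_const I n c : open I -> joint_Ck I n (fun _ _ => c).
Proof.
  intro HI. revert c; induction n as [|n IH]; intro c.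
  - split; [intros; apply continuity_2d_pt_const|exact Logic.I].
  - apply (joint_Ck_intro I n _ (fun _ _ => 0) (fun _ _ => 0)); auto.
    intros; split; apply @is_derive_const.
Qed.

Lemma joint_Ck_space I n : open I -> joint_Ck I n (fun _ x => x).
Proof.
  intro HI. destruct n as [|n].
  - split; [intros; apply continuity_2d_pt_id2|exact Logic.I].
  - apply (joint_Ck_intro I n _ (fun _ _ => 0) (fun _ _ => 1)); auto using joint_Ck_const.
    intros; split; [apply @is_derive_const|apply @is_derive_id].
Qed.

Lemma joint_Ck_plus I n F G : open I -> joint_Ck I n F -> joint_Ck I n G ->
  joint_Ck I n (fun t x => F t x + G t x).
Proof.
  intro HI. revert F G; induction n as [|n IH]; intros F G HF HG.
  - split; [|exact Logic.I]. intros t x It.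
    apply continuity_2d_pt_plus; now apply (joint_Ck_continuous I 0).
  - apply (joint_Ck_intro I n _ (fun t x => dt F t x + dt G t x) (fun t x => dx F t x + dx G t x)).
    + auto.
    + intros t x It. destruct (joint_Ck_is_derive I n F t x HF It),
        (joint_Ck_is_derive I n G t x HG It).
      split; now apply @is_derive_plus.
    + apply IH; [apply HF|apply HG].
    + apply IH; [apply HF|apply HG].
Qed.

Lemma joint_Ck_mult I n F G : open I -> joint_Ck I n F -> joint_Ck I n G ->
  joint_Ck I n (fun t x => F t x * G t x).
Proof.
  intro HI. revert F G; induction n as [|n IH]; intros F G HF HG.
  - split; [|exact Logic.I]. intros t x It.
    apply continuity_2d_pt_mult; now apply (joint_Ck_continuous I 0).
  - apply (joint_Ck_intro I n _ (fun t x => dt F t x * G t x + F t x * dt G t x)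
      (fun t x => dx F t x * G t x + F t x * dx G t x)).
    + auto.
    + intros t x It. destruct (joint_Ck_is_derive I n F t x HF It),
        (joint_Ck_is_derive I n G t x HG It).
      split.
      * apply (is_derive_mult (fun s => F s x) (fun s => G s x)); auto using Rmult_comm.
      * apply (is_derive_mult (F t) (G t)); auto using Rmult_comm.
    + apply joint_Ck_plus; auto; apply IH; auto using joint_Ck_S; (apply HF || apply HG).
    + apply joint_Ck_plus; auto; apply IH; auto using joint_Ck_S; (apply HF || apply HG).
Qed.

Lemma joint_Ck_inv I n F : open I -> (forall t x, I t -> F t x <> 0) -> joint_Ck I n F ->
  joint_Ck I n (fun t x => / F t x).
Proof.
  intros HI H0. induction n as [|n IH]; intro HF.
  - split; [|exact Logic.I]. intros t x It.
    apply continuity_2d_pt_inv; auto. now apply (joint_Ck_continuous I 0).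
  - pose proof (IH (joint_Ck_S _ _ _ HF)) as Hi.
    apply (joint_Ck_intro I n _ (fun t x => -1 * dt F t x * (/ F t x * / F t x))
      (fun t x => -1 * dx F t x * (/ F t x * / F t x))).
    + auto.
    + intros t x It. destruct (joint_Ck_is_derive I n F t x HF It) as [D1 D2].
      split; evar_last.
      * apply (is_derive_inv (fun s => F s x) t _ D1); auto.
      * simpl; field; auto.
      * apply (is_derive_inv (F t) x _ D2); auto.
      * simpl; field; auto.
    + repeat apply joint_Ck_mult; auto using joint_Ck_const; apply HF.
    + repeat apply joint_Ck_mult; auto using joint_Ck_const; apply HF.
Qed.

Lemma joint_Ck_comp I n F psi : open I -> joint_Ck I n F -> joint_Ck I n psi ->
  joint_Ck I n (fun t x => F t (psi t x)).
Proof.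
  intro HI. revert F; induction n as [|n IH]; intros F HF Hp.
  - split; [|exact Logic.I]. intros t x It.
    pose proof (joint_Ck_continuous _ _ _ t (psi t x) HF It) as CF.
    pose proof (joint_Ck_continuous _ _ _ t x Hp It) as Cp.
    intro eps. destruct (CF eps) as [d1 Hd1]. destruct (Cp d1) as [d2 Hd2].
    exists (mkposreal (Rmin d1 d2) (Rmin_stable_in_posreal d1 d2)). simpl. intros s y Hs Hy.
    apply Rmin_Rgt in Hs, Hy. apply Hd1; [apply Hs|apply Hd2; [apply Hs|apply Hy]].
  - pose proof (IH _ (proj1 (proj2 (proj2 HF))) (joint_Ck_S _ _ _ Hp)) as Ct.
    pose proof (IH _ (proj2 (proj2 (proj2 HF))) (joint_Ck_S _ _ _ Hp)) as Cx.
    apply (joint_Ck_intro I n _ (fun t x => dt F t (psi t x) + dx F t (psi t x) * dt psi t x)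
      (fun t x => dx F t (psi t x) * dx psi t x)).
    + auto.
    + intros t x It.
      destruct (joint_Ck_is_derive I n psi t x Hp It) as [D1 D2]. split.
      * apply is_derive_Reals.
        replace (dt F t (psi t x)) with (dt F t (psi t x) * 1) by ring.
        apply (derivable_pt_lim_comp_2d F (fun s => s) (fun s => psi s x)).
        -- apply (C1_differentiable I); auto.
           ++ intros s y Is. now apply (joint_Ck_is_derive I n F s y HF Is).
           ++ now apply (joint_Ck_is_derive I n F t (psi t x) HF It).
           ++ apply (joint_Ck_continuous I n); [apply HF|exact It].
        -- apply derivable_pt_lim_id.
        -- now apply is_derive_Reals.
      * rewrite Rmult_comm. apply (is_derive_comp (F t) (psi t)); [|exact D2].
        now apply (joint_Ck_is_derive I n F t (psi t x) HF It).
    + apply joint_Ck_plus; auto. apply joint_Ck_mult; auto. apply Hp.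
    + apply joint_Ck_mult; auto. apply Hp.
Qed.

Definition joint_smooth (I : R -> Prop) (F : R -> R -> R) : Prop := forall n, joint_Ck I n F.

Lemma joint_smooth_dt I F : joint_smooth I F -> joint_smooth I (dt F).
Proof. intros H n. apply (H (S n)). Qed.

Lemma joint_smooth_dx I F : joint_smooth I F -> joint_smooth I (dx F).
Proof. intros H n. apply (H (S n)). Qed.

Lemma joint_smooth_smooth I F t : joint_smooth I F -> I t -> smooth (F t).
Proof.
  intros H It. apply smooth_Ck. intro n. revert F H; induction n as [|n IH]; intros F H.
  - exact Logic.I.
  - split; [intro x; now apply (H 1%nat)|]. apply (IH (dx F)). now apply joint_smooth_dx.
Qed.

Lemma joint_smooth_Schwarz I F t x : open I -> joint_smooth I F -> I t ->
  dx (dt F) t x = dt (dx F) t x.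
Proof.
  intros HI H It. unfold dx, dt. symmetry.
  apply (Schwarz F t x).
  - apply (open_locally_2d I); auto. intros s y Is.
    destruct (H 1%nat) as [_ [H1 _]]. destruct (H1 s y Is) as [A1 A2].
    destruct (joint_smooth_dt I F H 1%nat) as [_ [H2 _]]. destruct (H2 s y Is) as [A3 A4].
    destruct (joint_smooth_dx I F H 1%nat) as [_ [H3 _]]. destruct (H3 s y Is) as [A5 A6].
    auto.
  - apply (joint_smooth_dt _ _ (joint_smooth_dx _ _ H) O); auto.
  - apply (joint_smooth_dx _ _ (joint_smooth_dt _ _ H) O); auto.
Qed.

(** * Derivatives of curves *)

(** Differentiability of a curve at [t] in every [C^k] norm. *)
Definition has_curve_derive (c : R -> R -> R) (t : R) (d : R -> R) : Prop :=
  forall k eps, 0 < eps -> exists delta, 0 < delta /\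
    forall h, h <> 0 -> Rabs h < delta ->
      Cnorm_le k eps (fun x => (c (t + h) x - c t x) / h - d x).

Lemma open_shift (I : R -> Prop) t : open I -> I t ->
  exists delta, 0 < delta /\ forall h, Rabs h < delta -> I (t + h).
Proof.
  intros HI It. destruct (HI t It) as [e He]. exists e. split; [apply cond_pos|].
  intros h Hh. apply He. change (Rabs (t + h - t) < e).
  now replace (t + h - t) with h by ring.
Qed.

(** By the mean value theorem the difference quotient of [F] is a value of
    [dt F] at a nearby time, and [dt F] is uniformly continuous over a period.
    The higher space derivatives follow by induction, as [dx] commutes with
    [dt]. *)
Lemma joint_smooth_has_curve_derive I F t : open I -> joint_smooth I F ->
  (forall t x, I t -> F t (x + 1) = F t x) -> I t -> has_curve_derive F t (dt F t).
Proof.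
  intros HI HF Hper It k. revert F HF Hper.
  assert (Hsup : forall F, joint_smooth I F -> (forall t x, I t -> F t (x + 1) = F t x) ->
    forall eps, 0 < eps -> exists delta, 0 < delta /\ forall h, h <> 0 -> Rabs h < delta ->
      forall x, Rabs ((F (t + h) x - F t x) / h - dt F t x) <= eps).
  { intros F HF Hper eps Heps.
    destruct (open_shift I t HI It) as [d1 [Hd1 HI1]].
    destruct (uniform_continuity_2d_1d' (dt F) 0 1 t) with (eps := mkposreal eps Heps)
      as [d2 Hd2].
    { intros x _. now apply (joint_smooth_dt I F HF O). }
    exists (Rmin d1 d2). split; [apply Rmin_glb_lt; [auto|apply cond_pos]|].
    intros h Hh0 Hh x.
    assert (Hh1 : Rabs h < d1) by (apply Rlt_le_trans with (1 := Hh), Rmin_l).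
    assert (Hh2 : Rabs h < d2) by (apply Rlt_le_trans with (1 := Hh), Rmin_r).
    destruct (periodic_reduce (fun x => Rabs ((F (t + h) x - F t x) / h - dt F t x)) x)
      as [y [Hy <-]].
    { intro z. assert (E : dt F t (z + 1) = dt F t z)
        by (apply Derive_ext_loc, (open_locally I); auto).
      now rewrite E, !Hper by auto. }
    assert (HIs : forall s, Rmin t (t + h) <= s <= Rmax t (t + h) -> Rabs (s - t) <= Rabs h).
    { intro s. unfold Rmin, Rmax. destruct Rle_dec; split_Rabs; lra. }
    assert (HD : forall s, Rmin t (t + h) <= s <= Rmax t (t + h) ->
      is_derive (fun s => F s y) s (dt F s y)).
    { intros s Hs. apply (joint_Ck_is_derive I O F s y (HF 1%nat)).
      replace s with (t + (s - t)) by ring. apply HI1.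
      apply Rle_lt_trans with (2 := Hh1). now apply HIs. }
    destruct (MVT_gen (fun s => F s y) t (t + h) (fun s => dt F s y)) as [c [Hc E]].
    - intros s Hs. apply HD. lra.
    - intros s Hs. apply continuity_pt_filterlim.
      apply (ex_derive_continuous (V := R_NormedModule) (fun s => F s y)).
      eexists; now apply HD.
    - cbv beta in E. rewrite E. replace (dt F c y * (t + h - t) / h) with (dt F c y)
        by (field; auto).
      specialize (HIs c Hc). left. apply Hd2; auto; try lra.
      + pose proof (cond_pos d2). lra.
      + apply Rabs_le_between in HIs. lra.
      + rewrite Rminus_diag, Rabs_R0. apply cond_pos. }
  induction k as [|k IH]; intros F HF Hper eps Heps.
  - destruct (Hsup F HF Hper eps Heps) as [d [Hd H]]. exists d. split; [auto|].
    intros h Hh0 Hh. apply Cnorm_le_0. now apply H.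
  - destruct (Hsup F HF Hper eps Heps) as [d1 [Hd1 H1]].
    destruct (IH (dx F) (joint_smooth_dx _ _ HF)) with (eps := eps) as [d2 [Hd2 H2]]; auto.
    { intros s x Is. pose proof (joint_smooth_smooth _ _ _ HF Is) as Hs.
      apply (Cinf_Derive (F s)). split; auto. }
    destruct (open_shift I t HI It) as [d3 [Hd3 H3]].
    exists (Rmin d1 (Rmin d2 d3)). split; [now repeat apply Rmin_glb_lt|].
    intros h Hh0 Hh.
    apply Rmin_Rgt in Hh. destruct Hh as [Hh1 Hh]. apply Rmin_Rgt in Hh.
    destruct Hh as [Hh2 Hh3].
    apply Cnorm_le_S. split; [now apply H1|].
    replace (Derive (fun x => (F (t + h) x - F t x) / h - dt F t x))
      with (fun x => (dx F (t + h) x - dx F t x) / h - dt (dx F) t x); [now apply H2|].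
    symmetry. apply is_derive_Derive. intro x.
    rewrite <- (joint_smooth_Schwarz I F t x) by auto.
    apply (is_derive_minus (fun x => (F (t + h) x - F t x) / h) (dt F t)).
    + replace ((dx F (t + h) x - dx F t x) / h)
        with (/ h * (dx F (t + h) x - dx F t x)) by (field; auto).
      apply is_derive_ext with (fun x => / h * (F (t + h) x - F t x)).
      * intro y. simpl. apply Rmult_comm.
      * apply is_derive_scal, @is_derive_minus.
        -- apply (joint_Ck_is_derive I 0); auto.
        -- apply (joint_Ck_is_derive I 0); auto.
    + apply (joint_Ck_is_derive I 0); auto. now apply joint_smooth_dt.
Qed.

(** * Smooth curves are jointly smooth *)

Lemma open_in_itv t0 t1 : open (in_itv t0 t1).
Proof. apply open_and; [apply open_Rbar_gt|apply open_Rbar_lt]. Qed.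

Lemma Derive_n_quotient f g d h j x : Cinf f -> Cinf g -> Cinf d ->
  Derive_n (fun x => (f x - g x) / h - d x) j x
  = (Derive_n f j x - Derive_n g j x) / h - Derive_n d j x.
Proof.
  intros Hf Hg Hd.
  replace (fun x => (f x - g x) / h - d x) with (fun x => / h * (f x - g x) - d x)
    by (apply functional_extensionality; intro; unfold Rdiv; ring).
  rewrite Derive_n_minus_Cinf by auto using Cinf_scal, Cinf_minus.
  rewrite Derive_n_scal_l, Derive_n_minus_Cinf by auto. unfold Rdiv; ring.
Qed.

(** Neighbourhoods in the Frechet space only concern smooth functions, so the
    difference quotients have to be smooth for small increments. *)
Lemma is_curve_derive_has_curve_derive c t d : is_curve_derive c t d -> Cinf d ->
  (locally' 0 (fun h => Cinf (fun x => (c (t + h) x - c t x) / h))) ->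
  has_curve_derive c t d.
Proof.
  intros H Hd Hq k eps Heps.
  set (P := fun g => Cinf g -> Cnorm_le k eps (fun x => g x - d x)).
  assert (HP : Cinf_locally d P).
  { exists k, (mkposreal eps Heps). intros g Hg Hgd _ j x Hj.
    rewrite Derive_n_minus_Cinf by auto. left. now apply Hgd. }
  destruct (H P HP) as [e1 H1]. destruct Hq as [e2 H2].
  exists (Rmin e1 e2). split; [apply Rmin_stable_in_posreal|].
  intros h Hh0 Hh. apply Rmin_Rgt in Hh. destruct Hh as [Hh1 Hh2].
  assert (Hb : forall e, Rabs h < e -> ball 0 e h).
  { intros e He. change (Rabs (h - 0) < e). now rewrite Rminus_0_r. }
  apply (H1 h (Hb _ Hh1) Hh0). now apply (H2 h (Hb _ Hh2)).
Qed.

Lemma locally'_quotient_Cinf (I : R -> Prop) c t : open I -> I t ->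
  (forall s, I s -> Cinf (c s)) ->
  locally' 0 (fun h => Cinf (fun x => (c (t + h) x - c t x) / h)).
Proof.
  intros HI It Hc. destruct (open_shift I t HI It) as [e [He H]].
  exists (mkposreal e He). intros h Hh _.
  change (Rabs (h - 0) < e) in Hh. rewrite Rminus_0_r in Hh.
  replace (fun x => (c (t + h) x - c t x) / h) with (fun x => / h * (c (t + h) x - c t x))
    by (apply functional_extensionality; intro; unfold Rdiv; ring).
  apply Cinf_scal, Cinf_minus; auto.
Qed.

Lemma has_curve_derive_is_derive (I : R -> Prop) c t d j x : open I -> I t ->
  (forall s, I s -> Cinf (c s)) -> Cinf d -> has_curve_derive c t d ->
  is_derive (fun s => Derive_n (c s) j x) t (Derive_n d j x).
Proof.
  intros HI It Hc Hd H. apply is_derive_Reals. intros eps Heps.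
  destruct (H j (eps / 2)) as [d1 [Hd1 H1]]; [lra|].
  destruct (open_shift I t HI It) as [d2 [Hd2 H2]].
  exists (mkposreal (Rmin d1 d2) (Rmin_glb_lt _ _ _ Hd1 Hd2)). simpl.
  intros h Hh0 Hh. apply Rmin_Rgt in Hh. destruct Hh as [Hh1 Hh2].
  rewrite <- Derive_n_quotient by auto.
  apply Rle_lt_trans with (eps / 2); [|lra]. apply H1; auto.
Qed.

(** Equicontinuity: a difference quotient bounded uniformly in space makes the
    dependence on time Lipschitz at [t], uniformly in space. *)
Lemma has_curve_derive_continuity (I : R -> Prop) c t d j x : open I -> I t ->
  (forall s, I s -> Cinf (c s)) -> Cinf d -> has_curve_derive c t d ->
  continuity_2d_pt (fun s y => Derive_n (c s) j y) t x.
Proof.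
  intros HI It Hc Hd H eps.
  destruct (H j 1) as [d1 [Hd1 H1]]; [lra|].
  destruct (open_shift I t HI It) as [d2 [Hd2 H2]].
  destruct (Cinf_Cnorm_le d j Hd) as [D HD]. pose proof (Cnorm_le_pos _ _ _ HD) as HD0.
  pose proof (smooth_continuous _ x (Cinf_smooth _ (Derive_n_Cinf (c t) j (Hc t It)))) as Hx.
  assert (He2 : 0 < eps / 2) by (pose proof (cond_pos eps); lra).
  destruct (Hx (ball (Derive_n (c t) j x) (mkposreal _ He2))) as [d3 H3];
    [apply locally_ball|].
  set (d4 := eps / 2 / (D + 2)).
  assert (Hd4 : 0 < d4) by (apply Rdiv_lt_0_compat; lra).
  assert (Hm : 0 < Rmin (Rmin d1 d2) (Rmin d3 d4))
    by (repeat apply Rmin_glb_lt; auto; apply cond_pos).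
  exists (mkposreal _ Hm). simpl. intros s y Hs Hy.
  apply Rmin_Rgt in Hs, Hy. destruct Hs as [Hs Hs'], Hy as [_ Hy].
  apply Rmin_Rgt in Hs, Hs', Hy. destruct Hs as [Hs1 Hs2], Hs' as [_ Hs4], Hy as [Hy3 _].
  specialize (H3 y Hy3). change (Rabs (Derive_n (c t) j y - Derive_n (c t) j x) < eps / 2) in H3.
  assert (Hst : Rabs (Derive_n (c s) j y - Derive_n (c t) j y) <= (D + 1) * Rabs (s - t)).
  { destruct (Req_dec s t) as [->|Hne].
    - rewrite !Rminus_diag, Rabs_R0. lra.
    - assert (Hh : s - t <> 0) by lra.
      specialize (H1 (s - t) Hh Hs1 j y (Nat.le_refl j)).
      assert (Is : I (t + (s - t))) by now apply H2.
      rewrite Derive_n_quotient in H1 by auto.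
      replace (t + (s - t)) with s in H1 by ring.
      specialize (HD j y (Nat.le_refl j)).
      set (p := Derive_n (c s) j y - Derive_n (c t) j y) in *.
      replace p with (p / (s - t) * (s - t)) by (field; auto).
      rewrite Rabs_mult. apply Rmult_le_compat_r; [apply Rabs_pos|].
      split_Rabs; lra. }
  assert ((D + 2) * Rabs (s - t) < eps / 2).
  { replace (eps / 2) with ((D + 2) * d4) by (unfold d4; field; lra).
    apply Rmult_lt_compat_l; [lra|exact Hs4]. }
  pose proof (Rabs_pos (s - t)).
  replace (Derive_n (c s) j y - Derive_n (c t) j x) with
    ((Derive_n (c s) j y - Derive_n (c t) j y) + (Derive_n (c t) j y - Derive_n (c t) j x))
    by ring.
  apply Rle_lt_trans with (1 := Rabs_triang _ _). nra.
Qed.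

(** The functions [Derive_n (dt_n c n t) j] are the mixed partial derivatives;
    differentiating one in time or space increments [n] or [j]. *)
Lemma smooth_curve_joint_smooth t0 t1 c : smooth_curve t0 t1 c -> joint_smooth (in_itv t0 t1) c.
Proof.
  intro H. set (I := in_itv t0 t1). pose proof (open_in_itv t0 t1 : open I) as HI.
  assert (HC : forall n t, I t -> Cinf (dt_n c n t)) by (intros n t It; apply (H t It n)).
  assert (HD : forall n t, I t -> has_curve_derive (dt_n c n) t (dt_n c (S n) t)).
  { intros n t It. apply is_curve_derive_has_curve_derive; [apply H, It|now apply HC|].
    apply (locally'_quotient_Cinf I); auto. }
  intro N.
  enough (HN : forall n j, joint_Ck I N (fun t x => Derive_n (dt_n c n t) j x)) by exact (HN O O).
  induction N as [|N IH]; intros n j.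
  - split; [|exact Logic.I]. intros t x It.
    apply (has_curve_derive_continuity I) with (dt_n c (S n) t); auto.
  - apply (joint_Ck_intro I N _ _ _ HI) with (2 := IH (S n) j) (3 := IH n (S j)).
    intros t x It. split.
    + apply (has_curve_derive_is_derive I); auto.
    + apply (Derive_correct (Derive_n (dt_n c n t) j)).
      now apply Cinf_ex_derive, Derive_n_Cinf, HC.
Qed.

(** * Diffeomorphisms of the circle and their inverses *)

Lemma Diff1_is_derive f x : Diff1 f -> is_derive f x (1 + Derive (chart f) x).
Proof.
  intros [[Hc _] _].
  apply is_derive_ext with (fun x => x + chart f x).
  - intro y. unfold chart. eq_R. ring.
  - apply @is_derive_plus; [apply @is_derive_id|now apply Derive_correct, Cinf_ex_derive].
Qed.

Lemma Diff1_increasing f x y : Diff1 f -> x < y -> f x < f y.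
Proof.
  intros Hf Hxy.
  destruct (MVT_gen f x y (fun x => 1 + Derive (chart f) x)) as [c [_ E]].
  - intros; now apply Diff1_is_derive.
  - intros z _. apply continuity_pt_filterlim.
    apply (ex_derive_continuous (V := R_NormedModule) f).
    eexists; now apply Diff1_is_derive.
  - pose proof (proj2 Hf c). nra.
Qed.

Lemma Diff1_lt_inv f x y : Diff1 f -> f x < f y -> x < y.
Proof.
  intros Hf H. destruct (Rlt_le_dec x y) as [|[Hlt|E]]; [auto| |subst; lra].
  pose proof (Diff1_increasing f y x Hf Hlt). lra.
Qed.

Lemma Diff1_inj f x y : Diff1 f -> f x = f y -> x = y.
Proof.
  intros Hf E. destruct (Rtotal_order x y) as [H|[H|H]]; [|auto|];
    apply (Diff1_increasing f) in H; auto; lra.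
Qed.

Lemma Diff1_0 f : Diff1 f -> f 0 = 0.
Proof. intros [[_ H] _]. unfold chart in H. lra. Qed.

Lemma Diff1_shift f x : Diff1 f -> f (x + 1) = f x + 1.
Proof. intros [[[H _] _] _]. specialize (H x). unfold chart in H. lra. Qed.

(** A bounded perturbation of the identity takes all values. *)
Lemma Diff1_surj f y : Diff1 f -> exists x, f x = y.
Proof.
  intro Hf. destruct (Cinf_bounded (chart f)) as [M HM]; [apply Hf|].
  assert (HfM : forall x, x - M <= f x <= x + M).
  { intro x. specialize (HM x). unfold chart in HM. apply Rabs_le_between in HM. lra. }
  destruct (IVT_gen f (y - M) (y + M) y) as [x [_ Hx]].
  - intro z. apply continuity_pt_filterlim.
    apply (ex_derive_continuous (V := R_NormedModule) f).
    eexists; now apply Diff1_is_derive.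
  - pose proof (HfM (y - M)). pose proof (HfM (y + M)).
    split; [apply Rle_trans with (1 := Rmin_l _ _)|apply Rle_trans with (2 := Rmax_r _ _)]; lra.
  - now exists x.
Qed.

Lemma inv_fun_r f y : Diff1 f -> f (inv_fun f y) = y.
Proof. intro Hf. unfold inv_fun. apply epsilon_spec, Diff1_surj, Hf. Qed.

Lemma inv_fun_l f x : Diff1 f -> inv_fun f (f x) = x.
Proof. intro Hf. apply (Diff1_inj f); [auto|]. now rewrite inv_fun_r. Qed.

Lemma inv_fun_0 f : Diff1 f -> inv_fun f 0 = 0.
Proof. intro Hf. pose proof (inv_fun_l f 0 Hf) as E. now rewrite Diff1_0 in E. Qed.

Lemma inv_fun_shift f y : Diff1 f -> inv_fun f (y + 1) = inv_fun f y + 1.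
Proof.
  intro Hf. apply (Diff1_inj f); [auto|].
  now rewrite (Diff1_shift f), !inv_fun_r by auto.
Qed.

(** By the mean value theorem in [y],
    [G s (g s) - G s (g s0) = Gy s eta (g s - g s0)] for some [eta] between
    [g s0] and [g s]; divide by [s - s0] and let [s] tend to [s0].  It is stated
    with pointwise hypotheses so as to serve for both partial derivatives of the
    inverse. *)
Lemma implicit_derive (G Gy : R -> R -> R) (g : R -> R) (s0 Gs : R) :
  locally s0 (fun s => G s (g s) = 0) ->
  locally s0 (fun s => forall y, is_derive (G s) y (Gy s y)) ->
  continuity_2d_pt Gy s0 (g s0) -> Gy s0 (g s0) <> 0 ->
  is_derive (fun s => G s (g s0)) s0 Gs -> continuous g s0 ->
  is_derive g s0 (- Gs / Gy s0 (g s0)).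
Proof.
  intros HG HGy Hc H0 Hs Hg.
  set (y0 := g s0) in *.
  assert (Hlim : forall (f : R -> R) l, is_derive f s0 l <->
    is_lim (fun h => (f (s0 + h) - f s0) / h) 0 l).
  { intros f l. rewrite is_derive_Reals, <- is_lim_spec. split.
    - intros H eps. destruct (H eps (cond_pos eps)) as [d Hd]. exists d.
      intros h Hh Hh0. apply Hd; auto.
      change (Rabs (h - 0) < d) in Hh. now rewrite Rminus_0_r in Hh.
    - intros H eps Heps. destruct (H (mkposreal eps Heps)) as [d Hd]. exists d.
      intros h Hh0 Hh. apply Hd; auto.
      change (Rabs (h - 0) < d). now rewrite Rminus_0_r. }
  apply Hlim. apply Hlim in Hs.
  destruct (filter_and _ _ HG HGy) as [d0 Hd0].
  assert (Hball : forall h, Rabs h < d0 -> ball s0 d0 (s0 + h)).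
  { intros h Hh. change (Rabs (s0 + h - s0) < d0). now replace (s0 + h - s0) with h by ring. }
  assert (Heta : forall h, exists eta, Rabs h < d0 ->
    Rabs (eta - y0) <= Rabs (g (s0 + h) - y0) /\
    G (s0 + h) (g (s0 + h)) - G (s0 + h) y0 = Gy (s0 + h) eta * (g (s0 + h) - y0)).
  { intro h. destruct (Rlt_le_dec (Rabs h) d0) as [Hh|Hh]; [|exists 0; lra].
    destruct (Hd0 _ (Hball h Hh)) as [_ D].
    destruct (MVT_gen (G (s0 + h)) y0 (g (s0 + h)) (Gy (s0 + h))) as [c [Hcc E]]; auto.
    - intros z _. apply continuity_pt_filterlim.
      apply (ex_derive_continuous (V := R_NormedModule) (G (s0 + h))). eexists; apply D.
    - exists c. intros _. split; [|exact E].
      revert Hcc. unfold Rmin, Rmax. destruct Rle_dec; intro; split_Rabs; lra. }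
  (* The intermediate points are chosen at once, to speak of their limit. *)
  set (eta := fun h => epsilon (inhabits 0) (fun eta => Rabs h < d0 ->
    Rabs (eta - y0) <= Rabs (g (s0 + h) - y0) /\
    G (s0 + h) (g (s0 + h)) - G (s0 + h) y0 = Gy (s0 + h) eta * (g (s0 + h) - y0))).
  assert (Hee : forall h, Rabs h < d0 ->
    Rabs (eta h - y0) <= Rabs (g (s0 + h) - y0) /\
    G (s0 + h) (g (s0 + h)) - G (s0 + h) y0 = Gy (s0 + h) (eta h) * (g (s0 + h) - y0)).
  { intro h. exact (epsilon_spec (inhabits 0) _ (Heta h)). }
  assert (HlimGy : is_lim (fun h => Gy (s0 + h) (eta h)) 0 (Gy s0 y0)).
  { apply is_lim_spec. intro eps. destruct (Hc eps) as [d1 Hd1].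
    destruct (Hg (ball y0 d1) (locally_ball _ _)) as [d2 Hd2].
    assert (Hm : 0 < Rmin d0 (Rmin d1 d2))
      by (repeat apply Rmin_glb_lt; apply cond_pos).
    exists (mkposreal _ Hm). intros h Hh _.
    change (Rabs (h - 0) < Rmin d0 (Rmin d1 d2)) in Hh. rewrite Rminus_0_r in Hh.
    apply Rmin_Rgt in Hh. destruct Hh as [Hh0 Hh]. apply Rmin_Rgt in Hh.
    destruct Hh as [Hh1 Hh2].
    apply Hd1.
    - now rewrite Rplus_minus_l.
    - apply Rle_lt_trans with (1 := proj1 (Hee h Hh0)).
      apply (Hd2 (s0 + h)). change (Rabs (s0 + h - s0) < d2).
      now rewrite Rplus_minus_l. }
  assert (HGne : Rbar_locally' 0 (fun h => Gy (s0 + h) (eta h) <> 0)).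
  { apply is_lim_spec in HlimGy.
    destruct (HlimGy (mkposreal _ (Rabs_pos_lt _ H0))) as [d Hd]. exists d.
    intros h Hh Hh0 E. specialize (Hd h Hh Hh0). simpl in Hd. rewrite E in Hd.
    rewrite <- Rabs_Ropp in Hd. replace (- (0 - Gy s0 y0)) with (Gy s0 y0) in Hd by ring. lra. }
  apply is_lim_ext_loc with
    (fun h => - ((G (s0 + h) y0 - G s0 y0) / h) / Gy (s0 + h) (eta h)).
  - destruct HGne as [d1 Hd1].
    exists (mkposreal (Rmin d0 d1) (Rmin_stable_in_posreal d0 d1)). intros h Hh Hh0.
    change (Rabs (h - 0) < Rmin d0 d1) in Hh. rewrite Rminus_0_r in Hh.
    apply Rmin_Rgt in Hh. destruct Hh as [Hh1 Hh2].
    assert (Hne : Gy (s0 + h) (eta h) <> 0).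
    { apply Hd1; auto. change (Rabs (h - 0) < d1). now rewrite Rminus_0_r. }
    destruct (Hee h Hh1) as [_ E].
    rewrite (proj1 (Hd0 _ (Hball h Hh1))) in E.
    assert (E0 : G s0 y0 = 0) by (apply (Hd0 s0), ball_center).
    rewrite E0. fold y0.
    replace (G (s0 + h) y0) with (- (Gy (s0 + h) (eta h) * (g (s0 + h) - y0))) by lra.
    field. auto.
  - apply (is_lim_div _ _ 0 (- Gs) (Gy s0 y0)); auto.
    + apply (is_lim_opp _ 0 Gs). exact Hs.
    + intro E. apply H0. now injection E.
    + exact Logic.I.
Qed.

(** The inverse [psi] satisfies [psi_t = - phi_t / phi_x] and
    [psi_x = 1 / phi_x], the right-hand sides being evaluated at [psi]: if [psi]
    is regular to order [n], so are they, and [psi] is regular to order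
    [n + 1].  The induction starts from the joint continuity of [psi], which
    follows from monotonicity in space. *)
Lemma inverse_joint_smooth (I : R -> Prop) phi : open I -> (forall t, I t -> Diff1 (phi t)) ->
  joint_smooth I phi -> joint_smooth I (fun t => inv_fun (phi t)).
Proof.
  intros HI HD Hs. set (psi := fun t => inv_fun (phi t)).
  assert (Hpos : forall t x, I t -> 0 < dx phi t x).
  { intros t x It. unfold dx. pose proof (HD t It) as Df.
    rewrite (is_derive_unique _ _ _ (Diff1_is_derive _ x Df)).
    pose proof (proj2 Df x). lra. }
  (* [phi s (y - eps) < x' < phi s (y + eps)] persists for nearby [s] and [x']. *)
  assert (H0 : forall t x, I t -> continuity_2d_pt psi t x).
  { intros t x It eps. set (y := psi t x).
    assert (Ey : phi t y = x) by now apply inv_fun_r, HD.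
    set (d1 := x - phi t (y - eps)). set (d2 := phi t (y + eps) - x).
    pose proof (cond_pos eps) as He.
    assert (Hd1 : 0 < d1).
    { unfold d1. rewrite <- Ey. apply Rlt_0_minus, Diff1_increasing; [auto|lra]. }
    assert (Hd2 : 0 < d2).
    { unfold d2. rewrite <- Ey. apply Rlt_0_minus, Diff1_increasing; [auto|lra]. }
    assert (Hm : 0 < Rmin d1 d2 / 2).
    { pose proof (Rmin_glb_lt d1 d2 0 Hd1 Hd2). lra. }
    destruct (Hs O) as [Hc _].
    destruct (Hc t (y - eps) It (mkposreal _ Hm)) as [e1 H1].
    destruct (Hc t (y + eps) It (mkposreal _ Hm)) as [e2 H2].
    destruct (HI t It) as [e3 H3].
    assert (Hmm : 0 < Rmin (Rmin e1 e2) (Rmin e3 (Rmin d1 d2 / 2)))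
      by (repeat apply Rmin_glb_lt; auto; apply cond_pos).
    exists (mkposreal _ Hmm). simpl. intros s x' Hst Hx.
    apply Rmin_Rgt in Hst, Hx. destruct Hst as [Hst Hst'], Hx as [_ Hx].
    apply Rmin_Rgt in Hst, Hst', Hx.
    destruct Hst as [Hs1 Hs2], Hst' as [Hs3 _], Hx as [_ Hx].
    assert (Is : I s) by (apply H3; exact Hs3).
    specialize (H1 s (y - eps) Hs1). specialize (H2 s (y + eps) Hs2).
    simpl in H1, H2. rewrite Rminus_diag, Rabs_R0 in H1, H2.
    specialize (H1 (cond_pos e1)). specialize (H2 (cond_pos e2)).
    pose proof (Rmin_l d1 d2). pose proof (Rmin_r d1 d2).
    apply Rabs_def2 in H1, H2, Hx.
    assert (Ex : phi s (psi s x') = x') by now apply inv_fun_r, HD.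
    apply Rabs_def1.
    - assert (psi s x' < y + eps); [|lra].
      apply (Diff1_lt_inv (phi s)); [auto|]. rewrite Ex. unfold d2 in *. lra.
    - assert (y - eps < psi s x'); [|lra].
      apply (Diff1_lt_inv (phi s)); [auto|]. rewrite Ex. unfold d1 in *. lra. }
  assert (Hdt : forall t x, I t ->
    is_derive (fun s => psi s x) t (- dt phi t (psi t x) / dx phi t (psi t x))).
  { intros t x It.
    apply (implicit_derive (fun s y => phi s y - x) (dx phi) (fun s => psi s x)).
    - apply (open_locally I); auto. intros s Is. unfold psi.
      rewrite inv_fun_r by auto. ring.
    - apply (open_locally I); auto. intros s Is y.
      replace (dx phi s y) with (dx phi s y - 0) by ring.
      apply (is_derive_minus (phi s) (fun _ => x)); [|apply @is_derive_const].
      now apply (joint_Ck_is_derive I 0 phi s y (Hs 1%nat)).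
    - now apply (joint_smooth_dx _ _ Hs O).
    - pose proof (Hpos t (psi t x) It). lra.
    - replace (dt phi t (psi t x)) with (dt phi t (psi t x) - 0) by ring.
      apply (is_derive_minus (fun s => phi s (psi t x)) (fun _ => x));
        [|apply @is_derive_const].
      now apply (joint_Ck_is_derive I 0 phi t (psi t x) (Hs 1%nat)).
    - intros P [e He]. destruct (H0 t x It e) as [d Hd]. exists d. intros s Hst.
      apply He, Hd; [exact Hst|]. rewrite Rminus_diag, Rabs_R0. apply cond_pos. }
  assert (Hdx : forall t x, I t -> is_derive (psi t) x (/ dx phi t (psi t x))).
  { intros t x It.
    replace (/ dx phi t (psi t x)) with (- -1 / dx phi t (psi t x))
      by (pose proof (Hpos t (psi t x) It); field; lra).
    apply (implicit_derive (fun z y => phi t y - z) (fun _ y => dx phi t y) (psi t)).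
    - apply filter_forall. intro z. unfold psi. rewrite inv_fun_r by auto. ring.
    - apply filter_forall. intros z y.
      replace (dx phi t y) with (dx phi t y - 0) by ring.
      apply (is_derive_minus (phi t) (fun _ => z)); [|apply @is_derive_const].
      now apply (joint_Ck_is_derive I 0 phi t y (Hs 1%nat)).
    - intro eps. destruct (joint_smooth_dx _ _ Hs O) as [Hc _].
      destruct (Hc t (psi t x) It eps) as [d Hd]. exists d. intros z y _ Hy.
      apply Hd; [|exact Hy]. rewrite Rminus_diag, Rabs_R0. apply cond_pos.
    - pose proof (Hpos t (psi t x) It). lra.
    - auto_derive; [exact Logic.I|ring].
    - apply continuity_2d_pt_slice, H0, It. }
  intro n. induction n as [|n IH]; [split; [exact H0|exact Logic.I]|].
  assert (Hi : joint_Ck I n (fun t x => / dx phi t (psi t x))).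
  { apply joint_Ck_inv; auto.
    - intros t x It. pose proof (Hpos t (psi t x) It). lra.
    - apply joint_Ck_comp; auto. now apply joint_smooth_dx. }
  apply (joint_Ck_intro I n _ (fun t x => -1 * dt phi t (psi t x) * / dx phi t (psi t x))
    (fun t x => / dx phi t (psi t x))); auto.
  - intros t x It. split; [|now apply Hdx].
    evar_last; [now apply Hdt|].
    pose proof (Hpos t (psi t x) It). eq_R. field. lra.
  - apply joint_Ck_mult; auto. apply joint_Ck_mult; auto using joint_Ck_const.
    apply joint_Ck_comp; auto. now apply joint_smooth_dt.
Qed.

(** * Eulerian fields *)

Lemma dt_chart phi : dt (fun t => chart (phi t)) = dt phi.
Proof.
  apply functional_extensionality; intro t. apply functional_extensionality; intro x.
  unfold dt, Derive. f_equal. apply Lim_ext. intro h. unfold chart. f_equal. ring.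
Qed.

Lemma smooth_Diff1_curve_joint_smooth t0 t1 phi : smooth_Diff1_curve t0 t1 phi ->
  joint_smooth (in_itv t0 t1) phi.
Proof.
  intros [_ H] n. apply joint_Ck_ext with (fun t x => chart (phi t) x + x).
  - apply open_in_itv.
  - intros t x _. unfold chart. ring.
  - apply joint_Ck_plus; [apply open_in_itv| |apply joint_Ck_space, open_in_itv].
    now apply smooth_curve_joint_smooth.
Qed.

(** Curves in the Lie algebra to which the calculus above applies: both the
    given vector fields and their Eulerian forms are of this kind. *)
Definition field_along (I : R -> Prop) (xi : R -> R -> R) : Prop :=
  joint_smooth I xi /\ forall t, I t -> C0inf (xi t).

Lemma smooth_curve_field t0 t1 xi : smooth_curve t0 t1 xi -> field_along (in_itv t0 t1) xi.
Proof.
  intro H. split; [now apply smooth_curve_joint_smooth|]. intros t It. apply (H t It O).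
Qed.

Lemma velocity_field t0 t1 phi : smooth_Diff1_curve t0 t1 phi ->
  field_along (in_itv t0 t1) (dt phi).
Proof.
  intro H. split; [now apply joint_smooth_dt, smooth_Diff1_curve_joint_smooth|].
  intros t It. rewrite <- dt_chart. apply (proj2 H t It 1%nat).
Qed.

Lemma field_along_dt I w : open I -> field_along I w -> field_along I (dt w).
Proof.
  intros HI [Hs H]. pose proof (joint_smooth_dt _ _ Hs) as Hd. split; [exact Hd|].
  intros t It. split; [split|].
  - intro x. apply Derive_ext_loc, (open_locally I); auto. intros s Is. apply (H s Is).
  - now apply (joint_smooth_smooth I).
  - transitivity (Derive (fun _ => 0) t); [|apply Derive_const].
    apply Derive_ext_loc, (open_locally I); auto. intros s Is. apply (H s Is).
Qed.

Lemma field_along_curve_derive I w t : open I -> field_along I w -> I t ->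
  has_curve_derive w t (dt w t).
Proof.
  intros HI [Hs H] It. apply (joint_smooth_has_curve_derive I); auto.
  intros s x Is. apply (H s Is).
Qed.

(** Composition with the inverse of the flow preserves joint smoothness, and
    the flow fixes 0 and commutes with integer translations. *)
Lemma field_along_eulerian t0 t1 phi xi : smooth_Diff1_curve t0 t1 phi ->
  field_along (in_itv t0 t1) xi -> field_along (in_itv t0 t1) (eulerian phi xi).
Proof.
  intros Hphi [Hs H]. set (I := in_itv t0 t1) in *.
  assert (Hj : joint_smooth I (eulerian phi xi)).
  { intro n. apply (joint_Ck_comp I n xi (fun t => inv_fun (phi t))); auto using open_in_itv.
    - apply open_in_itv.
    - apply inverse_joint_smooth; [apply open_in_itv|apply Hphi|].
      now apply smooth_Diff1_curve_joint_smooth. }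
  split; [exact Hj|]. intros t It. pose proof (proj1 Hphi t It) as HD.
  destruct (H t It) as [[Hp _] H0]. split; [split|].
  - intro x. unfold eulerian. now rewrite inv_fun_shift, Hp.
  - now apply (joint_smooth_smooth I).
  - unfold eulerian. now rewrite inv_fun_0.
Qed.

(** * Geodesics and the metric *)

(** First order expansion in time with a remainder small in [C^k]; in this
    form linear and bilinear functionals apply to it directly. *)
Lemma curve_increment (I : R -> Prop) w t k eps : open I -> field_along I w -> I t -> 0 < eps ->
  exists delta, 0 < delta /\ forall h, h <> 0 -> Rabs h < delta -> exists r,
    Cinf r /\ Cnorm_le k eps r /\ Cinf (w (t + h)) /\
    w (t + h) = (fun x => w t x + h * (dt w t x + r x)).
Proof.
  intros HI Hw It Heps.
  destruct (field_along_curve_derive I w t HI Hw It k eps Heps) as [d1 [Hd1 Hr]].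
  destruct (open_shift I t HI It) as [d2 [Hd2 Hq]].
  exists (Rmin d1 d2). split; [now apply Rmin_glb_lt|].
  intros h Hh0 Hh. apply Rmin_Rgt in Hh. destruct Hh as [Hh1 Hh2].
  assert (Cw : Cinf (w (t + h))) by (apply Hw; now apply Hq).
  exists (fun x => (w (t + h) x - w t x) / h - dt w t x). split; [|split; [|split]].
  - apply Cinf_minus; [|now apply (field_along_dt I)].
    replace (fun x => (w (t + h) x - w t x) / h) with (fun x => / h * (w (t + h) x - w t x))
      by (apply functional_extensionality; intro; unfold Rdiv; ring).
    apply Cinf_scal, Cinf_minus; [auto|now apply Hw].
  - now apply Hr.
  - exact Cw.
  - apply functional_extensionality; intro x. field. auto.
Qed.

Lemma is_derive_Lambda_curve (I : R -> Prop) w t x : open I -> field_along I w -> I t ->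
  is_derive (fun s => Lambda (w s) x) t (Lambda (dt w t) x).
Proof.
  intros HI Hw It. apply is_derive_Reals. intros eps Heps.
  destruct (curve_increment I w t 3 (eps / 2) HI Hw It) as [d [Hd H]]; [lra|].
  exists (mkposreal d Hd). simpl. intros h Hh0 Hh.
  destruct (H h Hh0 Hh) as [r [Cr [Nr [_ ->]]]].
  pose proof (proj1 (proj2 Hw t It)) as Cw.
  pose proof (proj1 (proj2 (field_along_dt I w HI Hw) t It)) as Cd.
  rewrite Lambda_plus, Lambda_scal, Lambda_plus by auto using Cinf_scal, Cinf_plus.
  replace ((Lambda (w t) x + h * (Lambda (dt w t) x + Lambda r x) - Lambda (w t) x) / h
           - Lambda (dt w t) x) with (Lambda r x) by (field; auto).
  apply Rle_lt_trans with (eps / 2); [|lra].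
  apply (proj1 (Cnorm_le_0 _ _) (Cnorm_le_Lambda 0 _ r Cr Nr)).
Qed.

(** The product rule for a continuous bilinear form. *)
Lemma is_derive_pairing (I : R -> Prop) w z t : open I -> field_along I w ->
  field_along I z -> I t ->
  is_derive (fun s => pairing (w s) (z s)) t (pairing (dt w t) (z t) + pairing (w t) (dt z t)).
Proof.
  intros HI Hw Hz It.
  pose proof (proj1 (proj2 Hw t It)) as Cw. pose proof (proj1 (proj2 Hz t It)) as Cz.
  pose proof (proj1 (proj2 (field_along_dt I w HI Hw) t It)) as Cdw.
  pose proof (proj1 (proj2 (field_along_dt I z HI Hz) t It)) as Cdz.
  destruct (Cinf_Cnorm_le _ 3 Cw) as [M HM]. destruct (Cinf_Cnorm_le _ 3 Cz) as [N HN].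
  destruct (Cinf_Cnorm_le _ 3 Cdw) as [M' HM']. destruct (Cinf_Cnorm_le _ 3 Cdz) as [N' HN'].
  pose proof (Cnorm_le_pos _ _ _ HM). pose proof (Cnorm_le_pos _ _ _ HN).
  pose proof (Cnorm_le_pos _ _ _ HM'). pose proof (Cnorm_le_pos _ _ _ HN').
  apply is_derive_Reals. intros eps Heps.
  (* The error is [<r, z> + <w, q> + h <w_t + r, z_t + q>] for remainders [r]
     and [q]. *)
  set (K := M + N + (M' + 1) * (N' + 1)).
  assert (HK' : 0 < (M' + 1) * (N' + 1)) by (apply Rmult_lt_0_compat; lra).
  assert (HK : 0 < K) by (unfold K; lra).
  set (e := Rmin 1 (eps / (2 * K))).
  assert (He : 0 < e) by (apply Rmin_glb_lt; [|apply Rdiv_lt_0_compat]; lra).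
  assert (He1 : e <= 1) by apply Rmin_l.
  assert (HeK : e * K <= eps / 2).
  { apply Rle_trans with (eps / (2 * K) * K).
    - apply Rmult_le_compat_r; [lra|apply Rmin_r].
    - right; field; lra. }
  destruct (curve_increment I w t 3 e HI Hw It He) as [d1 [Hd1 Hr]].
  destruct (curve_increment I z t 3 e HI Hz It He) as [d2 [Hd2 Hq]].
  assert (Hm : 0 < Rmin e (Rmin d1 d2)) by (apply Rmin_glb_lt; [|apply Rmin_glb_lt]; auto).
  exists (mkposreal _ Hm). simpl. intros h Hh0 Hh.
  apply Rmin_Rgt in Hh. destruct Hh as [Hhe Hh].
  apply Rmin_Rgt in Hh. destruct Hh as [Hh1 Hh2].
  destruct (Hr h Hh0 Hh1) as [r [Cr [Nr [_ ->]]]].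
  destruct (Hq h Hh0 Hh2) as [q [Cq [Nq [_ ->]]]].
  set (rr := fun x => dt w t x + r x). set (qq := fun x => dt z t x + q x).
  assert (Crr : Cinf rr) by now apply Cinf_plus.
  assert (Cqq : Cinf qq) by now apply Cinf_plus.
  assert (Nrr : Cnorm_le 3 (M' + 1) rr).
  { apply (Cnorm_le_le 3 3 (M' + e)); [lia|lra|]. now apply Cnorm_le_plus. }
  assert (Nqq : Cnorm_le 3 (N' + 1) qq).
  { apply (Cnorm_le_le 3 3 (N' + e)); [lia|lra|]. now apply Cnorm_le_plus. }
  change (fun x => w t x + h * (dt w t x + r x)) with (fun x => w t x + h * rr x).
  change (fun x => z t x + h * (dt z t x + q x)) with (fun x => z t x + h * qq x).
  rewrite (pairing_plus_l (w t) (fun x => h * rr x)), (pairing_scal_l h rr),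
    (pairing_plus_r (z t) (fun x => h * qq x) (w t)),
    (pairing_plus_r (z t) (fun x => h * qq x) rr),
    (pairing_scal_r h qq (w t)), (pairing_scal_r h qq rr)
    by auto using Cinf_scal, Cinf_plus.
  assert (Er : pairing rr (z t) = pairing (dt w t) (z t) + pairing r (z t))
    by now apply pairing_plus_l.
  assert (Eq : pairing (w t) qq = pairing (w t) (dt z t) + pairing (w t) q)
    by now apply pairing_plus_r.
  rewrite Er, Eq.
  match goal with |- Rabs ?y < _ =>
    replace y with (pairing r (z t) + (pairing (w t) q + h * pairing rr qq)) by (field; auto)
  end.
  assert (N0 : forall P f, Cnorm_le 3 P f -> Cnorm_le 0 P f)
    by (intros P f; apply Cnorm_le_le; [lia|lra]).
  pose proof (pairing_bound e N r (z t) Cr Cz (N0 _ _ Nr) HN) as B1.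
  pose proof (pairing_bound M e (w t) q Cw Cq (N0 _ _ HM) Nq) as B2.
  pose proof (pairing_bound _ _ rr qq Crr Cqq (N0 _ _ Nrr) Nqq) as B3.
  apply Rle_lt_trans with (e * K); [|lra].
  apply Rle_trans with (1 := Rabs_triang _ _).
  replace (e * K) with (e * N + (M * e + e * ((M' + 1) * (N' + 1)))) by (unfold K; ring).
  apply Rplus_le_compat; [exact B1|].
  apply Rle_trans with (1 := Rabs_triang _ _).
  apply Rplus_le_compat; [exact B2|].
  rewrite Rabs_mult. apply Rmult_le_compat; auto using Rabs_pos. lra.
Qed.

Lemma cov_derive_eulerian a phi xi t y :
  cov_derive (mCLM_connection a) phi xi t y
  = dt (eulerian phi xi) t (phi t y)
    + cov_term a (velocity phi t) (eulerian phi xi t) (phi t y).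
Proof. unfold cov_derive, cov_term. simpl. ring. Qed.

(** The flow is surjective at each time, so the vanishing of the covariant
    derivative along it is the Eulerian equation at every point; differentiating
    [Lambda u] in time gives [Lambda u_t]. *)
Lemma geodesic_iff_mCLM a t0 t1 phi : smooth_Diff1_curve t0 t1 phi ->
  geodesic (mCLM_connection a) t0 t1 phi <-> mCLM a t0 t1 (velocity phi).
Proof.
  intro Hphi. set (I := in_itv t0 t1). pose proof (open_in_itv t0 t1 : open I) as HI.
  pose proof (field_along_eulerian t0 t1 phi _ Hphi (velocity_field t0 t1 phi Hphi)) as Hu.
  fold (velocity phi) I in Hu. set (u := velocity phi) in *.
  pose proof (field_along_dt I u HI Hu) as Hut.
  assert (Hgeo : forall t, I t ->
    ((forall y, cov_derive (mCLM_connection a) phi (dt phi) t y = 0)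
     <-> forall x, dt u t x + christoffel a (u t) (u t) x = 0)).
  { intros t It. pose proof (proj1 Hphi t It) as HD.
    assert (E : forall y, cov_derive (mCLM_connection a) phi (dt phi) t y
      = dt u t (phi t y) + christoffel a (u t) (u t) (phi t y)).
    { intro y. rewrite cov_derive_eulerian.
      fold (velocity phi) u. unfold cov_term. ring. }
    split; intros H x.
    - rewrite <- (inv_fun_r (phi t) x) by auto. now rewrite <- E.
    - rewrite E. apply H. }
  assert (HmCLM : forall t x, I t ->
    ex_derive (fun s => Lambda (u s) x) t /\ ex_derive (Lambda (u t)) x /\
    dt (fun t => Lambda (u t)) t x = Lambda (dt u t) x /\
    Derive (Lambda (u t)) x = Lambda (Derive (u t)) x).
  { intros t x It. pose proof (proj1 (proj2 Hu t It)) as Cu.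
    pose proof (is_derive_Lambda_curve I u t x HI Hu It) as D.
    repeat split.
    - eexists; exact D.
    - now apply Cinf_ex_derive, Cinf_Lambda.
    - now apply is_derive_unique.
    - now rewrite Derive_Lambda. }
  unfold geodesic, mCLM. split; intros H t It.
  - pose proof (proj1 (Hgeo t It) (H t It)) as Hg.
    rewrite geodesic_equation in Hg by (apply Hu || apply Hut; exact It).
    intro x. destruct (HmCLM t x It) as [E1 [E2 [E3 E4]]].
    rewrite E3, E4. auto.
  - apply (Hgeo t It).
    apply geodesic_equation; [now apply Hu|now apply Hut|].
    intro x. destruct (HmCLM t x It) as [_ [_ [E3 E4]]].
    destruct (H t It x) as [_ [_ E]]. rewrite E3, E4 in E. exact E.
Qed.

Lemma Hhalf_compatible : compatible_with Hhalf_metric (mCLM_connection 2).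
Proof.
  intros t0 t1 phi xi eta Hphi Hxi Heta t It.
  set (I := in_itv t0 t1). pose proof (open_in_itv t0 t1 : open I) as HI.
  pose proof (field_along_eulerian t0 t1 phi _ Hphi (velocity_field t0 t1 phi Hphi)) as Hu.
  pose proof (field_along_eulerian t0 t1 phi _ Hphi (smooth_curve_field _ _ _ Hxi)) as Hw.
  pose proof (field_along_eulerian t0 t1 phi _ Hphi (smooth_curve_field _ _ _ Heta)) as Hz.
  fold (velocity phi) I in Hu. fold I in Hw, Hz.
  set (u := velocity phi) in *. set (w := eulerian phi xi) in *.
  set (z := eulerian phi eta) in *.
  pose proof (proj1 (proj2 Hu t It)) as Cu.
  pose proof (proj1 (proj2 Hw t It)) as Cw. pose proof (proj1 (proj2 Hz t It)) as Cz.
  pose proof (proj1 (proj2 (field_along_dt I w HI Hw) t It)) as Cdw.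
  pose proof (proj1 (proj2 (field_along_dt I z HI Hz) t It)) as Cdz.
  pose proof (proj1 Hphi t It) as HD.
  assert (Hcov : forall zeta, (fun x => cov_derive (mCLM_connection 2) phi zeta t
      (inv_fun (phi t) x))
    = (fun x => dt (eulerian phi zeta) t x + cov_term 2 (u t) (eulerian phi zeta t) x)).
  { intro zeta. apply functional_extensionality; intro x.
    rewrite cov_derive_eulerian. now rewrite inv_fun_r. }
  assert (E1 : Hhalf_metric (phi t) (cov_derive (mCLM_connection 2) phi xi t) (eta t)
    = pairing (dt w t) (z t) + pairing (cov_term 2 (u t) (w t)) (z t)).
  { rewrite <- (pairing_plus_l (dt w t) (cov_term 2 (u t) (w t)) (z t))
      by auto using Cinf_cov_term.
    unfold w. rewrite <- Hcov. reflexivity. }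
  assert (E2 : Hhalf_metric (phi t) (xi t) (cov_derive (mCLM_connection 2) phi eta t)
    = pairing (w t) (dt z t) + pairing (w t) (cov_term 2 (u t) (z t))).
  { rewrite <- (pairing_plus_r (dt z t) (cov_term 2 (u t) (z t)) (w t))
      by auto using Cinf_cov_term.
    unfold z. rewrite <- Hcov. reflexivity. }
  rewrite E1, E2.
  evar_last; [exact (is_derive_pairing I w z t HI Hw Hz It)|].
  pose proof (metric_defect (u t) (w t) (z t) Cu Cw Cz) as Hdef.
  eq_R. lra.
Qed.

Theorem theorem3p1 :
  forall a : R,
  exists B : ri_sym_connection,
    (forall (t0 t1 : Rbar) (phi : R -> R -> R),
       smooth_Diff1_curve t0 t1 phi ->
       (geodesic B t0 t1 phi <-> mCLM a t0 t1 (velocity phi))) /\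
    (a = 2 -> compatible_with Hhalf_metric B).
Proof.
  intro a. exists (mCLM_connection a). split.
  - intros t0 t1 phi. apply geodesic_iff_mCLM.
  - intros ->. apply Hhalf_compatible.
Qed.
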